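(* Let $T>0$ and let $\lambda:[0,T]\to\mathbb{R}$ be continuous with $\lambda\in C^2[0,T)$ and $|\lambda(T)-\lambda(t)|\ge 4\sqrt{T-t}$ for all $t\in[0,T)$. Assume that the Loewner curvature satisfies $9\le LC_\lambda(t)<\infty$ for all $t\in[0,T)$, and that there exists $\delta>0$ so that for all $s\in(0,T)$, $$\inf_{t\in[s,T)}LC_\lambda(t)\ \ge\ \delta\sqrt{T-s}\,|\lambda'(s)|.$$ Then the trace $\gamma$ driven by $\lambda$ satisfies that $\gamma(T)=\lim_{t\to T}\gamma(t)$ exists and is real.
   Context: $\mathbb{H}$ denotes the open upper half-plane. For a continuous driving function $\lambda$, let $g_t(z)$, $z\in\overline{\mathbb{H}}$, solve the chordal Loewner equation $\partial_t g_t(z)=\frac{2}{g_t(z)-\lambda(t)}$, $g_0(z)=z$. The Loewner hulls driven by $\lambda$ are $K_t=\{z\in\overline{\mathbb{H}} : g_s(z)=\lambda(s)\text{ for some }s\in[0,t]\}$ (the initial values for which the denominator reaches zero, in the limit, at some time $s\le t$, with $\lambda(0)$ included). A trace is a (continuous) curve $\gamma$ in $\overline{\mathbb{H}}$ such that, for all $t$, $K_t$ is the complement of the unbounded component of $\mathbb{H}\setminus\gamma[0,t]$. For $\lambda$ that is $C^2$ on $[0,T)$, the trace on $[0,T)$ exists and is a simple curve in $\mathbb{H}\cup\{\lambda(0)\}$ with $K_t=\gamma[0,t]$ for $t<T$. For $\lambda\in C^2[0,T)$ the Loewner curvature is $LC_\lambda(t)=0$ if $\lambda'(t)=0$, and $LC_\lambda(t)=\frac{\lambda'(t)^3}{\lambda''(t)}$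 otherwise (infinite if $\lambda''(t)=0\neq\lambda'(t)$). *)

(* Defs.v *)
From HB Require Import structures.
From mathcomp Require Import all_boot all_order all_algebra.
From mathcomp Require Export complex.
From mathcomp Require Import all_classical all_reals all_analysis.
Set Implicit Arguments.
Unset Strict Implicit.
Unset Printing Implicit Defensive.
Import Order.TTheory GRing.Theory Num.Theory.
Import numFieldNormedType.Exports.
Local Open Scope classical_set_scope.
Local Open Scope complex_scope.
Local Open Scope ring_scope.

(* The usual topology of the complex plane: that of R[i] as a numFieldType. *)
HB.instance Definition _ (R : rcfType) :=
  PseudoMetricNormedZmod.copy R[i] R[i]^o.

(* Difference quotients below are restricted to A, so that a derivative at an
   endpoint belonging to A is the one-sided one. *)
Definition derivable_on (R : realType) (A : set R) (f : R -> R) :=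
  forall x, A x -> cvg ((f y - f x) / (y - x) @[y --> within A x^']).

Definition derive_on (R : realType) (A : set R) (f : R -> R) (x : R) : R :=
  lim ((f y - f x) / (y - x) @[y --> within A x^']).

Definition C2_on (R : realType) (A : set R) (f : R -> R) :=
  [/\ derivable_on A f,
      derivable_on A (derive_on A f) &
      {within A, continuous (derive_on A (derive_on A f))}].

Definition loewner_curvature (R : realType) (A : set R) (lambda : R -> R)
    (t : R) : \bar R :=
  let d1 := derive_on A lambda t in
  let d2 := derive_on A (derive_on A lambda) t in
  if d1 == 0 then 0%E else if d2 == 0 then +oo%E else (d1 ^+ 3 / d2)%:E.

Definition upper_half_plane (R : realType) : set R[i] :=
  [set z | 0 < complex.Im z].

Definition closed_upper_half_plane (R : realType) : set R[i] :=
  [set z | 0 <= complex.Im z].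

(* g solves the Loewner equation on [0, s[.  The condition g u != lambda u is
   needed because x / 0 = 0 in a numFieldType. *)
Definition loewner_flow (R : realType) (lambda : R -> R) (z : R[i]) (s : R)
    (g : R -> R[i]) :=
  g 0 = z /\
  forall u : R, u \in `[0, s[ ->
    g u != (lambda u)%:C /\
    (g v - g u) / (v - u)%:C @[v --> within `[0, s[ u^']
      --> 2 / (g u - (lambda u)%:C).

(* g_s(z) = lambda(s) is understood in the limit: the flow of z exists on
   [0, s[ and extends continuously to s with the value lambda(s).  For s = 0
   this says z = lambda(0). *)
Definition loewner_hull (R : realType) (lambda : R -> R) (t : R) : set R[i] :=
  [set z | closed_upper_half_plane z /\
     exists s : R, s \in `[0, t] /\
     exists g, [/\ loewner_flow lambda z s g,
                   {within `[0, s], continuous g} &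
                   g s = (lambda s)%:C]].

Definition unbounded_component (R : realType) (D : set R[i]) : set R[i] :=
  [set z | D z /\ ~ bounded_set (connected_component D z)].

(* Complements are taken in the open half-plane, since real points other than
   lambda(0) need not belong to the hull. *)
Definition is_trace (R : realType) (T : R) (lambda : R -> R)
    (gamma : R -> R[i]) :=
  [/\ {within `[0, T[, continuous gamma},
      forall t : R, t \in `[0, T[ -> closed_upper_half_plane (gamma t) &
      forall t : R, t \in `[0, T[ ->
        loewner_hull lambda t `&` @upper_half_plane R =
        @upper_half_plane R `\`
          unbounded_component (@upper_half_plane R `\` gamma @` `[0, t])].

(* Main.v *)
Require Import Defs.
From mathcomp Require Import all_boot all_order all_algebra complex.
From mathcomp Require Import all_classical all_reals all_analysis.
From mathcomp Require Import ring lra.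
Import Order.TTheory GRing.Theory Num.Theory.
Import numFieldNormedType.Exports.
Local Open Scope classical_set_scope.
Local Open Scope complex_scope.
Local Open Scope ring_scope.
Set Implicit Arguments.
Unset Strict Implicit.
Unset Printing Implicit Defensive.

(** Why the theorem is true.

    After a reflection, lambda' > 0, and the curvature bound reads
    0 <= 9 lambda'' <= lambda'^3.  For u < T let z_u be the point whose flow
    reaches the singularity exactly at time u.  Along that flow write
    Z = X + iY for g_t(z_u) - lambda(t) and N = |Z|^2.  The proof controls
    z_u as u tends to T by following its flow from time u back to time 0,
    and it rests on one barrier: the circle lambda' N = 6 X.  When the
    curvature is identically 9 the flow of z_u runs along this circle; in
    general Q = lambda' N - 6 X satisfies a differential inequality
    Q' <= k Q, so that Q stays nonnegative backwards from time u
    ([traj_barrier]).  Three facts follow from Q >= 0.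

    - Order ([traj_order]).  For u1 < u2 let A = X2 - X1 and
      B = Re (1/Z1 - 1/Z2).  Then A' = -2B and B' = kB - cA, where c >= 0
      is exactly what the barrier gives.  Backwards in time this is a
      cooperative system, so A remains positive.  Hence Re z_u is
      nondecreasing in u; it is at most lambda(T), so it converges.  This
      is the analytic form of the picture that the curve driven by
      3 sqrt(2(1 - t)), of curvature 9, meets the line at a right angle.

    - Height ([traj_height]).  The barrier gives (X/Y)' <= - lambda' / (3Y),
      while Y^2 <= 4 (T - t) <= (lambda(T) - lambda(t))^2 / 4.  Comparison
      with the logarithm of lambda(T) - lambda(t) shows that X/Y at time 0
      is at least 2/3 ln ((lambda(T) - lambda(0)) / (lambda(T) - lambda(u))),
      which is unbounded as u tends to T.  As X is bounded, Im z_u tends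
      to 0.

    - Existence ([traj_close], [tip_exists]).  Two flows that end at time u
      on the circle, close to the singularity, are close on all of [0, u].
      So the flow that ends in the singularity, and with it z_u, is a limit
      of flows that are regular up to time u.

    It remains to recover the trace from the points z_u
    ([trace_hits_tip]).  The point z_u is in K_u but in no earlier hull, and
    it is a limit of points outside K_u, namely the initial values of the
    regular flows just mentioned.  A point with these properties is on
    gamma(]s, u]) for every s < u: otherwise a neighbourhood of it would
    avoid gamma([0, u]) and would lie in a single component of the
    complement.  Therefore gamma(t) is the limit of z_u as u decreases to t,
    and gamma inherits the limit of z_u at T. *)

(** * Calculus with pointwise formulas *)

(** The rules below are stated for functions written pointwise, the form that
    the syntax-directed tactics [der] and [cont] can decompose. *)
Lemma der_eq (R : realType) (f : R -> R) (x a b : R) :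
  is_derive x 1 f a -> a = b -> is_derive x 1 f b.
Proof. by move=> ? <-. Qed.

Lemma der_cst (R : realType) (c x : R) : is_derive x 1 (fun _ : R => c) 0.
Proof. exact: is_derive_cst. Qed.

Lemma der_id (R : realType) (x : R) : is_derive x 1 (fun t : R => t) 1.
Proof. exact: is_derive_id. Qed.

Lemma der_add (R : realType) (f g : R -> R) (x a b : R) :
  is_derive x 1 f a -> is_derive x 1 g b ->
  is_derive x 1 (fun t => f t + g t) (a + b).
Proof. by move=> df dg; exact: is_deriveD. Qed.

Lemma der_opp (R : realType) (f : R -> R) (x a : R) :
  is_derive x 1 f a -> is_derive x 1 (fun t => - f t) (- a).
Proof. by move=> df; exact: is_deriveN. Qed.

Lemma der_mul (R : realType) (f g : R -> R) (x a b : R) :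
  is_derive x 1 f a -> is_derive x 1 g b ->
  is_derive x 1 (fun t => f t * g t) (a * g x + f x * b).
Proof.
move=> df dg; apply: (der_eq (@is_deriveM R R f g x 1 a b df dg)).
by rewrite /GRing.scale /= addrC [a * _]mulrC.
Qed.

Lemma der_sq (R : realType) (f : R -> R) (x a : R) :
  is_derive x 1 f a -> is_derive x 1 (fun t => f t ^+ 2) (2 * f x * a).
Proof.
by move=> df; apply: (der_eq (der_mul df df)); ring.
Qed.

Lemma der_inv (R : realType) (f : R -> R) (x a : R) : f x != 0 ->
  is_derive x 1 f a -> is_derive x 1 (fun t => (f t)^-1) (- a / f x ^+ 2).
Proof.
move=> f0 df; apply: (der_eq (is_deriveV f0 df)).
by rewrite /GRing.scale /= mulrC mulrN mulNr.
Qed.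

Lemma der_comp (R : realType) (f g : R -> R) (x a b : R) :
  is_derive (g x) 1 f a -> is_derive x 1 g b ->
  is_derive x 1 (fun t => f (g t)) (a * b).
Proof. by move=> df dg; exact: is_derive1_comp. Qed.

Lemma der_exp (R : realType) (f : R -> R) (x a : R) :
  is_derive x 1 f a ->
  is_derive x 1 (fun t => expR (f t)) (expR (f x) * a).
Proof. by move=> df; apply: der_comp df; exact: is_derive_expR. Qed.

Lemma der_ln (R : realType) (f : R -> R) (x a : R) : 0 < f x ->
  is_derive x 1 f a -> is_derive x 1 (fun t => ln (f t)) ((f x)^-1 * a).
Proof. by move=> f0 df; apply: der_comp df; exact: is_derive1_ln. Qed.

Ltac der :=
  lazymatch goal with
  | |- is_derive _ _ (fun _ => ?c) _ => eapply der_cst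
  | |- is_derive _ _ (fun t => t) _ => eapply der_id
  | |- is_derive _ _ (fun t => @?f t + @?g t) _ => eapply (@der_add _ f g); [der|der]
  | |- is_derive _ _ (fun t => - @?f t) _ => eapply (@der_opp _ f); der
  | |- is_derive _ _ (fun t => @?f t * @?g t) _ => eapply (@der_mul _ f g); [der|der]
  | |- is_derive _ _ (fun t => @?f t ^+ 2) _ => eapply (@der_sq _ f); der
  | |- is_derive _ _ (fun t => (@?f t)^-1) _ => eapply (@der_inv _ f); [cbv beta; try eassumption|der]
  | |- is_derive _ _ (fun t => expR (@?f t)) _ => eapply (@der_exp _ f); der
  | |- is_derive _ _ (fun t => ln (@?f t)) _ => eapply (@der_ln _ f); [cbv beta; try eassumption|der]
  | |- _ => eassumption
  end.

(** Leaves the identity between the computed derivative and the stated one. *)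
Ltac deriv := eapply der_eq; [der|cbv beta].

Lemma cont_all (R : realType) (f : R -> R) :
  (forall x, {for x, continuous f}) -> continuous f.
Proof. by []. Qed.

Lemma cont_cst (R : realType) (c x : R) : {for x, continuous (fun _ : R => c)}.
Proof. exact: cst_continuous. Qed.

Lemma cont_id (R : realType) (x : R) : {for x, continuous (fun t : R => t)}.
Proof. exact: cvg_id. Qed.

Lemma cont_add (R : realType) (f g : R -> R) (x : R) :
  {for x, continuous f} -> {for x, continuous g} ->
  {for x, continuous (fun t => f t + g t)}.
Proof. exact: continuousD. Qed.

Lemma cont_opp (R : realType) (f : R -> R) (x : R) :
  {for x, continuous f} -> {for x, continuous (fun t => - f t)}.
Proof. exact: continuousN. Qed.

Lemma cont_mul (R : realType) (f g : R -> R) (x : R) :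
  {for x, continuous f} -> {for x, continuous g} ->
  {for x, continuous (fun t => f t * g t)}.
Proof. exact: continuousM. Qed.

Lemma cont_sq (R : realType) (f : R -> R) (x : R) :
  {for x, continuous f} -> {for x, continuous (fun t => f t ^+ 2)}.
Proof. by move=> cf; apply: cont_mul. Qed.

Lemma cont_inv (R : realType) (f : R -> R) (x : R) : f x != 0 ->
  {for x, continuous f} -> {for x, continuous (fun t => (f t)^-1)}.
Proof. by move=> f0 cf; apply: cvgV. Qed.

Lemma cont_comp (R : realType) (f g : R -> R) (x : R) :
  {for g x, continuous f} -> {for x, continuous g} ->
  {for x, continuous (fun t => f (g t))}.
Proof. by move=> cf cg; exact: continuous_comp. Qed.

Lemma cont_exp (R : realType) (f : R -> R) (x : R) :
  {for x, continuous f} -> {for x, continuous (fun t => expR (f t))}.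
Proof. by move=> cf; apply: cont_comp cf; exact: continuous_expR. Qed.

Lemma cont_ln (R : realType) (f : R -> R) (x : R) : 0 < f x ->
  {for x, continuous f} -> {for x, continuous (fun t => ln (f t))}.
Proof. by move=> f0 cf; apply: cont_comp cf; exact: continuous_ln. Qed.

Lemma cont_max (R : realType) (f g : R -> R) (x : R) :
  {for x, continuous f} -> {for x, continuous g} ->
  {for x, continuous (fun t => Num.max (f t) (g t))}.
Proof. exact: continuous_max. Qed.

Lemma cont_min (R : realType) (f g : R -> R) (x : R) :
  {for x, continuous f} -> {for x, continuous g} ->
  {for x, continuous (fun t => Num.min (f t) (g t))}.
Proof. exact: continuous_min. Qed.

Ltac cont :=
  lazymatch goal with
  | |- {for _, continuous (fun _ => ?c)} => apply cont_cst
  | |- {for _, continuous (fun t => t)} => apply cont_id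
  | |- {for _, continuous (fun t => @?f t + @?g t)} => apply (@cont_add _ f g); cont
  | |- {for _, continuous (fun t => - @?f t)} => apply (@cont_opp _ f); cont
  | |- {for _, continuous (fun t => @?f t * @?g t)} => apply (@cont_mul _ f g); cont
  | |- {for _, continuous (fun t => @?f t ^+ 2)} => apply (@cont_sq _ f); cont
  | |- {for _, continuous (fun t => (@?f t)^-1)} => apply (@cont_inv _ f); [cbv beta; try assumption|cont]
  | |- {for _, continuous (fun t => expR (@?f t))} => apply (@cont_exp _ f); cont
  | |- {for _, continuous (fun t => ln (@?f t))} => apply (@cont_ln _ f); [cbv beta; try assumption|cont]
  | |- _ => first
      [ assumption | match goal with H : continuous ?f |- {for _, continuous ?f} => exact (H _) end | idtac ]
  end.

Lemma der_cont (R : realType) (f : R -> R) (x a : R) :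
  is_derive x 1 f a -> {for x, continuous f}.
Proof. by case=> df _; exact/differentiable_continuous/derivable1_diffP. Qed.

(** The degenerate case a = b is allowed, so that callers need not split off
    empty intervals. *)
Lemma mean_value (R : realType) (f df : R -> R) (a b : R) : a <= b ->
  (forall x, a <= x <= b -> {for x, continuous f}) ->
  (forall x, a < x < b -> is_derive x 1 f (df x)) ->
  exists2 c, a <= c <= b & a < b -> a < c < b /\ f b - f a = df c * (b - a).
Proof.
move=> ab cf df'; move: ab; rewrite le_eqVlt => /orP[/eqP <-|ab].
  by exists a; rewrite ?lexx ?ltxx.
have [c cab e] : exists2 c, c \in `]a, b[%R & f b - f a = df c * (b - a).
  apply: MVT => //.
  apply: continuous_in_subspaceT => x; rewrite inE /= in_itv /=; exact: cf.
move: cab; rewrite in_itv /= => cab; exists c; last by [].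
by case/andP: cab => ac cb; rewrite !ltW.
Qed.

Lemma nonincr (R : realType) (f df : R -> R) (a b : R) : a <= b ->
  (forall x, a <= x <= b -> {for x, continuous f}) ->
  (forall x, a < x < b -> is_derive x 1 f (df x)) ->
  (forall x, a < x < b -> df x <= 0) -> f b <= f a.
Proof.
move=> ab cf df' d0; have [c cab H] := mean_value ab cf df'.
move: ab; rewrite le_eqVlt => /orP[/eqP -> //|ab].
have [cab' e] := H ab; rewrite -subr_le0 e.
by rewrite mulr_le0_ge0 ?d0 // subr_ge0 ltW.
Qed.

Lemma nondecr (R : realType) (f df : R -> R) (a b : R) : a <= b ->
  (forall x, a <= x <= b -> {for x, continuous f}) ->
  (forall x, a < x < b -> is_derive x 1 f (df x)) ->
  (forall x, a < x < b -> 0 <= df x) -> f a <= f b.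
Proof.
move=> ab cf df' d0; rewrite -lerN2.
apply: (@nonincr R (fun t => - f t) (fun t => - df t)) => //.
- by move=> x h; apply: cont_opp; exact: cf.
- by move=> x h; apply: der_opp; exact: df'.
- by move=> x h; rewrite oppr_le0 d0.
Qed.

(** Composition with [clamp a b] extends a function from [a, b] to the whole
    line by constants; this turns continuity on a segment into continuity
    everywhere. *)
Definition clamp (R : realType) (a b t : R) : R := Num.max a (Num.min t b).

Lemma clamp_cont (R : realType) (a b x : R) : {for x, continuous (clamp a b)}.
Proof.
have H : {for x, continuous (fun t : R => Num.max a (Num.min t b))}.
  apply: cont_max; first exact: cont_cst.
  by apply: cont_min; [exact: cont_id|exact: cont_cst].
exact: H.
Qed.

Lemma clamp_id (R : realType) (a b x : R) : a <= x <= b -> clamp a b x = x.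
Proof. by move=> /andP[ax xb]; rewrite /clamp min_l // max_r. Qed.

Lemma clamp_in (R : realType) (a b x : R) : a <= b -> a <= clamp a b x <= b.
Proof.
move=> ab; rewrite /clamp le_max lexx /= ge_max ab /= ge_min lexx orbT.
by [].
Qed.

Lemma cont_clamp (R : realType) (f : R -> R) (a b : R) : a <= b ->
  (forall x, a <= x <= b -> {for x, continuous f}) ->
  continuous (fun t => f (clamp a b t)).
Proof.
move=> ab cf x; apply: (@cont_comp _ f _ x _ (@clamp_cont R a b x)).
exact/cf/clamp_in.
Qed.

(** Integrating from a - 1 makes every point of [a, b] interior, so that the
    derivative is two-sided at the endpoints too. *)
Lemma antiderivative (R : realType) (f : R -> R) (a b : R) : a <= b ->
  continuous f ->
  exists F : R -> R, forall x, a <= x <= b -> is_derive x 1 F (f x).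
Proof.
move=> ab cf.
exists (fun x => parameterized_integral lebesgue_measure (a - 1) x f).
move=> x /andP[ax xb].
have ifab : lebesgue_measure.-integrable `[a - 1, b + 1] (EFin \o f).
  apply: continuous_compact_integrable; first exact: segment_compact.
  exact: continuous_subspaceT.
have xb1 : x < b + 1 by lra.
have ax1 : a - 1 < x by lra.
have [dF F'] := continuous_FTC1_closed xb1 ifab ax1 (cf x).
split; first exact: dF.
by rewrite -derive1E; exact: F'.
Qed.

(** * Differential inequalities and uniform limits *)

(** With K a primitive of k, the function f exp(-K) is nonincreasing; the
    constant is exp(K a - K b).  The next two lemmas read off how the sign of f
    propagates backwards and forwards. *)
Lemma gronwall (R : realType) (f df k : R -> R) (a b : R) : a <= b ->
  (forall x, a <= x <= b -> {for x, continuous f}) ->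
  (forall x, a < x < b -> is_derive x 1 f (df x)) ->
  (forall x, a <= x <= b -> {for x, continuous k}) ->
  (forall x, a < x < b -> df x <= k x * f x) ->
  exists2 c, 0 < c & f b * c <= f a.
Proof.
move=> ab cf df' ck dk.
have [K dK] := antiderivative ab (cont_clamp ab ck).
exists (expR (K a - K b)); first exact: expR_gt0.
have : f b * expR (- K b) <= f a * expR (- K a).
  apply: (@nonincr R (fun t => f t * expR (- K t))
    (fun t => (df t - k t * f t) * expR (- K t))) => //.
  - move=> x xab; apply: cont_mul; first exact: cf.
    by apply/cont_exp/cont_opp/der_cont/dK.
  - move=> x xab; have xab' : a <= x <= b by case/andP: xab => *; rewrite !ltW.
    have d1 := df' _ xab; have d2 := dK _ xab'; rewrite clamp_id // in d2.
    by deriv; ring.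
  - move=> x xab; rewrite mulr_le0_ge0 ?expR_ge0 // subr_le0; exact: dk.
rewrite [K a - _]addrC expRD mulrA -(ler_pM2r (expR_gt0 (K a))) -[leRHS]mulrA.
by rewrite -expRD addNr expR0 mulr1.
Qed.

Lemma gronwall_ge0 (R : realType) (f df k : R -> R) (a b : R) : a <= b ->
  (forall x, a <= x <= b -> {for x, continuous f}) ->
  (forall x, a < x < b -> is_derive x 1 f (df x)) ->
  (forall x, a <= x <= b -> {for x, continuous k}) ->
  (forall x, a < x < b -> df x <= k x * f x) ->
  0 <= f b -> 0 <= f a.
Proof.
move=> ab cf df' ck dk fb; have [c c0] := gronwall ab cf df' ck dk.
by apply: le_trans; rewrite mulr_ge0 // ltW.
Qed.

Lemma gronwall_le0 (R : realType) (f df k : R -> R) (a b : R) : a <= b ->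
  (forall x, a <= x <= b -> {for x, continuous f}) ->
  (forall x, a < x < b -> is_derive x 1 f (df x)) ->
  (forall x, a <= x <= b -> {for x, continuous k}) ->
  (forall x, a < x < b -> df x <= k x * f x) ->
  f a <= 0 -> f b <= 0.
Proof.
move=> ab cf df' ck dk fa; have [c c0 h] := gronwall ab cf df' ck dk.
by have := le_trans h fa; rewrite pmulr_lle0.
Qed.

Lemma growth_le (R : realType) (f df G dG : R -> R) (a b : R) : a <= b ->
  (forall x, a <= x <= b -> {for x, continuous f}) ->
  (forall x, a <= x <= b -> {for x, continuous G}) ->
  (forall x, a < x < b -> is_derive x 1 f (df x)) ->
  (forall x, a < x < b -> is_derive x 1 G (dG x)) ->
  (forall x, a < x < b -> `|df x| <= dG x) ->
  `|f b - f a| <= G b - G a.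
Proof.
move=> ab cf cG df' dG' H; rewrite ler_norml; apply/andP; split.
  have : f a + G a <= f b + G b.
    apply: (@nondecr R (fun t => f t + G t) (fun t => df t + dG t)) => //.
    - by move=> x h; apply: cont_add; auto.
    - by move=> x h; apply: der_add; auto.
    - by move=> x h; have := H _ h; rewrite ler_norml => /andP[]; lra.
  lra.
have : f b - G b <= f a - G a.
  apply: (@nonincr R (fun t => f t - G t) (fun t => df t - dG t)) => //.
  - by move=> x h; apply: cont_add; [|apply: cont_opp]; auto.
  - by move=> x h; apply: der_add; [|apply: der_opp]; auto.
  - by move=> x h; have := H _ h; rewrite ler_norml => /andP[]; lra.
lra.
Qed.

(** If G is a primitive of g, then k - G is nearly constant for the
    approximations k of f, so f - G is constant. *)
Lemma derive_unif_limit (R : realType) (f g : R -> R) (a b : R) : a <= b ->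
  (forall x, a <= x <= b -> {for x, continuous g}) ->
  (forall e, 0 < e -> exists k dk : R -> R, [/\
    forall x, a <= x <= b -> {for x, continuous k},
    forall x, a < x < b -> is_derive x 1 k (dk x),
    forall x, a <= x <= b -> `|k x - f x| <= e &
    forall x, a < x < b -> `|dk x - g x| <= e]) ->
  forall x, a < x < b -> is_derive x 1 f (g x).
Proof.
move=> ab cg H.
have [G dG] := antiderivative ab (cont_clamp ab cg).
have E x : a <= x <= b -> f x = G x + (f a - G a).
  move=> /andP[ax xb]; apply/eqP; rewrite -subr_eq0 -normr_eq0 eq_le normr_ge0 andbT.
  apply/ler_addgt0Pl => e e0; rewrite addr0.
  have e'0 : 0 < e / (2 + (b - a)) by apply: divr_gt0 => //; lra.
  have [k [dk [ck dk' kf dkg]]] := H _ e'0.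
  set e' := e / _ in e'0 kf dkg.
  have h1 : `|(k x - G x) - (k a - G a)| <= e' * x - e' * a.
    apply: (@growth_le R (fun t => k t - G t) (fun t => dk t - g t)
      (fun t => e' * t) (fun=> e')) => //.
    - move=> y /andP[ay yx]; apply: cont_add; first by apply: ck; rewrite ay (le_trans yx).
      by apply/cont_opp/der_cont/dG; rewrite ay (le_trans yx).
    - by move=> y _; cont.
    - move=> y /andP[ay yx]; have yb := lt_le_trans yx xb.
      have d1 : is_derive y 1 k (dk y) by apply: dk'; rewrite ay.
      have d2 : is_derive y 1 G (g y).
        by have := dG y; rewrite clamp_id; [apply|]; rewrite !ltW.
      by der.
    - by move=> y _; deriv; ring.
    - by move=> y /andP[ay yx]; apply: dkg; rewrite ay (lt_le_trans yx).
  have h2 : `|k x - f x| <= e' by apply: kf; rewrite ax.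
  have h3 : `|k a - f a| <= e' by apply: kf; rewrite lexx.
  have h4 : e' * (2 + (b - a)) = e by rewrite /e' divfK //; lra.
  have h5 : e' * (x - a) <= e' * (b - a) by rewrite ler_pM2l //; lra.
  rewrite ler_norml; move: h1 h2 h3; rewrite !ler_norml => /andP[? ?] /andP[? ?] /andP[? ?].
  apply/andP; split; lra.
move=> x /andP[ax xb].
have d1 : is_derive x 1 (fun t => G t + (f a - G a)) (g x).
  have := dG x; rewrite clamp_id; last by rewrite !ltW.
  move=> /(_ _) d; have {}d : is_derive x 1 G (g x) by apply: d; rewrite !ltW.
  by deriv; ring.
apply: near_eq_is_derive d1.
near=> t; rewrite -E //; apply/andP; split; apply: ltW; near: t.
  exact: lt_nbhsr.
exact: lt_nbhsl.
Unshelve. all: by end_near. Qed.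

Lemma unif_limit_cont (R : realType) (f : R -> R) :
  (forall e, 0 < e -> exists2 k : R -> R, continuous k &
     forall x, `|k x - f x| <= e) -> continuous f.
Proof.
move=> H x; apply/cvgrPdist_le => e e0.
have e3 : 0 < e / 3 by lra.
have [k ck kf] := H _ e3.
have /cvgrPdist_le /(_ _ e3) := ck x.
apply: filterS => t h.
have := kf x; have := kf t; move: h; rewrite !ler_norml.
by move=> /andP[? ?] /andP[? ?] /andP[? ?]; apply/andP; split; lra.
Qed.

(** Both the Picard iteration and the flows ending near the singularity are
    summable with ratio 1/2; the limit is a supremum of lower bounds, which
    gives the rate as well. *)
Lemma geo_lim (R : realType) (f : nat -> R) (C : R) : 0 <= C ->
  (forall n, `|f n.+1 - f n| <= C / 2 ^+ n) ->
  exists l, forall n, `|f n - l| <= 2 * C / 2 ^+ n.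
Proof.
move=> C0 H.
(* the intervals [f n - 2C/2^n, f n + 2C/2^n] are nested *)
have p2 n : 2 * C / 2 ^+ n.+1 = C / 2 ^+ n :> R.
  by rewrite exprS invfM; field; rewrite expf_neq0.
have p3 n : 2 * C / 2 ^+ n = 2 * (C / 2 ^+ n) :> R by rewrite mulrA.
have U n k : f n - 2 * C / 2 ^+ n <= f (n + k)%N - 2 * C / 2 ^+ (n + k)%N.
  elim: k => [|k IH]; first by rewrite addn0.
  apply: le_trans IH _; rewrite addnS p2 p3.
  by have := H (n + k)%N; rewrite ler_norml => /andP[]; lra.
have V n k : f (n + k)%N + 2 * C / 2 ^+ (n + k)%N <= f n + 2 * C / 2 ^+ n.
  elim: k => [|k IH]; first by rewrite addn0.
  apply: le_trans IH; rewrite addnS p2 p3.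
  by have := H (n + k)%N; rewrite ler_norml => /andP[]; lra.
have pos n : 0 <= 2 * C / 2 ^+ n :> R by rewrite divr_ge0 ?exprn_ge0 ?mulr_ge0.
have UV n m : f n - 2 * C / 2 ^+ n <= f m + 2 * C / 2 ^+ m.
  apply: le_trans (U n m) _; apply: le_trans (V m n); rewrite addnC.
  by have := pos (m + n)%N; lra.
pose S := [set f n - 2 * C / 2 ^+ n | n in [set: nat]].
exists (sup S) => n.
have h1 : f n - 2 * C / 2 ^+ n <= sup S.
  apply: ub_le_sup; last by exists n.
  by exists (f 0%N + 2 * C / 2 ^+ 0) => _ [m _ <-]; exact: UV.
have h2 : sup S <= f n + 2 * C / 2 ^+ n.
  by apply: ge_sup; [exists (f 0%N - 2 * C / 2 ^+ 0), 0%N|move=> _ [m _ <-]].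
by rewrite ler_norml; apply/andP; split; lra.
Qed.

Lemma geo_small (R : realType) (C e : R) : 0 < e -> exists n : nat, C / 2 ^+ n <= e.
Proof.
move=> e0; have [n hn] : exists n : nat, C / e < n%:R.
  by exists (Num.truncn (`|C / e|)).+1; apply: le_lt_trans (ler_norm _) (truncnS_gt _).
exists n; rewrite ler_pdivrMr ?exprn_gt0 // mulrC -ler_pdivrMr //.
apply: ltW; apply: lt_trans hn _; rewrite -natrX ltr_nat; exact: ltn_expl.
Qed.

(** * Existence of solutions of a planar differential equation *)

Lemma near_in_itv (R : realType) (a b x : R) (P : R -> Prop) : a < x < b ->
  (forall t, a < t < b -> P t) -> \forall t \near x, P t.
Proof.
move=> /andP[ax xb] H; near=> t; apply: H; apply/andP; split; near: t.
  exact: lt_nbhsr.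
exact: lt_nbhsl.
Unshelve. all: by end_near. Qed.

Lemma der_local (R : realType) (f g : R -> R) (a b x d : R) : a < x < b ->
  (forall t, a < t < b -> g t = f t) -> is_derive x 1 g d -> is_derive x 1 f d.
Proof. by move=> xab E; apply: near_eq_is_derive; apply: near_in_itv xab _. Qed.

Lemma primitive (R : realType) (f : R -> R) (u c : R) : 0 <= u -> continuous f ->
  exists F : R -> R, [/\ continuous F, F u = c &
    forall t, 0 < t < u -> is_derive t 1 F (f t)].
Proof.
move=> u0 cf; have [G dG] := antiderivative u0 cf.
exists (fun t => G (clamp 0 u t) - G u + c); split.
- have cG : continuous (fun t => G (clamp 0 u t)).
    by apply: cont_clamp => // x /dG; exact: der_cont.
  by apply: cont_all => x; cont.
- by rewrite clamp_id ?u0 ?lexx // subrr add0r.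
move=> t tu; apply: (@der_local _ _ (fun t => G t - G u + c) 0 u) => //.
  by move=> x /andP[x0 xu]; rewrite clamp_id // !ltW.
have d := dG t _; have {}d : is_derive t 1 G (f t).
  by apply: d; case/andP: tu => *; rewrite !ltW.
by deriv; ring.
Qed.

(** Solution with prescribed value at the right end u of the interval: the
    flows are followed backwards.  Consecutive iterates differ by at most
    A / 2^n exp (4 L (u - t)), a bound that the integral operator halves, so
    no smallness of the interval is needed. *)
Lemma picard (R : realType) (F1 F2 : R -> R -> R -> R) (L M u a0 b0 : R) :
  0 <= u -> 0 <= L ->
  (forall a b : R -> R, continuous a -> continuous b ->
     continuous (fun t => F1 t (a t) (b t)) /\
     continuous (fun t => F2 t (a t) (b t))) ->
  (forall t x y x' y', `|F1 t x y - F1 t x' y'| <= L * (`|x - x'| + `|y - y'|) /\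
     `|F2 t x y - F2 t x' y'| <= L * (`|x - x'| + `|y - y'|)) ->
  (forall t x y, `|F1 t x y| <= M /\ `|F2 t x y| <= M) ->
  exists a b : R -> R, [/\ continuous a /\ continuous b, a u = a0, b u = b0 &
    forall t, 0 < t < u -> is_derive t 1 a (F1 t (a t) (b t)) /\
                           is_derive t 1 b (F2 t (a t) (b t))].
Proof.
move=> u0 L0 Fc Flip Fb.
have M0 : 0 <= M by apply: le_trans (Fb 0 0 0).1.
pose S := {p : (R -> R) * (R -> R) | continuous p.1 /\ continuous p.2}.
pose stepP (p q : (R -> R) * (R -> R)) := [/\ q.1 u = a0, q.2 u = b0 &
  forall t, 0 < t < u -> is_derive t 1 q.1 (F1 t (p.1 t) (p.2 t)) /\
                         is_derive t 1 q.2 (F2 t (p.1 t) (p.2 t))].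
have stepE (p : S) : {q : S | stepP (sval p) (sval q)}.
  case: p => [[a b] /= [ca cb]]; apply: cid.
  have [A [cA Au dA]] := primitive a0 u0 (Fc _ _ ca cb).1.
  have [B [cB Bu dB]] := primitive b0 u0 (Fc _ _ ca cb).2.
  unshelve eexists; first by exists (A, B).
  by split => //= t tu; split; [exact: dA|exact: dB].
have p0 : S by exists (fun=> a0, fun=> b0); split => x; exact: cont_cst.
pose step p := sval (stepE p).
pose seqS n := iter n step (step p0).
pose a n := (sval (seqS n)).1; pose b n := (sval (seqS n)).2.
have ca n : continuous (a n) by rewrite /a; case: (seqS n) => [? []].
have cb n : continuous (b n) by rewrite /b; case: (seqS n) => [? []].
have st0 : stepP (sval p0) (sval (seqS 0)) by exact: svalP (stepE p0).
have st n : stepP (sval (seqS n)) (sval (seqS n.+1)).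
  exact: svalP (stepE (seqS n)).
have au n : a n u = a0 by case: n => [|n]; [case: st0|case: (st n)].
have bu n : b n u = b0 by case: n => [|n]; [case: st0|case: (st n)].
have da n t : 0 < t < u -> exists2 d1, `|d1| <= M & is_derive t 1 (a n) d1.
  move=> tu; case: n => [|n].
    by case: st0 => _ _ /(_ t tu) [h _]; eexists; [|exact: h]; exact: (Fb _ _ _).1.
  by case: (st n) => _ _ /(_ t tu) [h _]; eexists; [|exact: h]; exact: (Fb _ _ _).1.
have db n t : 0 < t < u -> exists2 d1, `|d1| <= M & is_derive t 1 (b n) d1.
  move=> tu; case: n => [|n].
    by case: st0 => _ _ /(_ t tu) [_ h]; eexists; [|exact: h]; exact: (Fb _ _ _).2.
  by case: (st n) => _ _ /(_ t tu) [_ h]; eexists; [|exact: h]; exact: (Fb _ _ _).2.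
pose E t := expR (4 * L * (u - t)).
pose A := 2 * M * u.
have A0 : 0 <= A by rewrite !mulr_ge0.
have cE : continuous E by apply: cont_all => s; rewrite /E; cont.
have dE (s : R) : is_derive s 1 E (- (4 * L) * E s).
  by have H : is_derive s 1 (fun t => expR (4 * L * (u - t))) (- (4 * L) * E s)
    by deriv; rewrite /E; ring.
have E1 t : t <= u -> 1 <= E t.
  by move=> tu; rewrite -expR0 ler_expR mulr_ge0 ?subr_ge0 ?mulr_ge0.
(* every iterate stays within M u of its end value, which bounds the first step *)
have base (x : nat -> R -> R) n c : (forall n, continuous (x n)) ->
    (forall n, x n u = c) ->
    (forall n t, 0 < t < u -> exists2 d1, `|d1| <= M & is_derive t 1 (x n) d1) ->
    forall t, 0 <= t <= u -> `|x n t - c| <= M * u.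
  move=> cx xu dx t /andP[t0 tu]; rewrite -(xu n) distrC.
  have /choice[d dP] : forall s, exists d1, 0 < s < u ->
      `|d1| <= M /\ is_derive s 1 (x n) d1.
    move=> s; have [su|su] := boolP (0 < s < u); last by exists 0.
    by have [d1 ? ?] := dx n s su; exists d1.
  apply: (@le_trans _ _ (M * u - M * t)); last first.
    by rewrite gerBl mulr_ge0.
  apply: (@growth_le R _ d (fun t => M * t) (fun=> M)) => //.
  - by move=> s _; exact: cx.
  - by move=> s _; cont.
  - move=> s /andP[ts su]; have sU : 0 < s < u by rewrite (le_lt_trans t0 ts).
    by have [] := dP _ sU.
  - by move=> s _; deriv; ring.
  - move=> s /andP[ts su]; have sU : 0 < s < u by rewrite (le_lt_trans t0 ts).
    by have [] := dP _ sU.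
have key n : forall t, 0 <= t <= u ->
    `|a n.+1 t - a n t| <= A / 2 ^+ n * E t /\ `|b n.+1 t - b n t| <= A / 2 ^+ n * E t.
  elim: n => [|n IH] t tu; have /andP[t0 tu'] := tu.
    have AE : A <= A / 2 ^+ 0 * E t by rewrite expr0 divr1 ler_peMr // E1.
    split; apply: le_trans AE.
      have := base a 1%N a0 ca au da t tu; have := base a 0%N a0 ca au da t tu.
      rewrite /A !ler_norml => /andP[? ?] /andP[? ?]; apply/andP; split; lra.
    have := base b 1%N b0 cb bu db t tu; have := base b 0%N b0 cb bu db t tu.
    rewrite /A !ler_norml => /andP[? ?] /andP[? ?]; apply/andP; split; lra.
  have An0 : 0 <= A / 2 ^+ n.+1 by rewrite divr_ge0 // exprn_ge0.
  have Ehalf : A / 2 ^+ n = 2 * (A / 2 ^+ n.+1).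
    by rewrite exprS invfM; field; rewrite expf_neq0.
  have step2 (x : nat -> R -> R) (F : R -> R -> R -> R) c :
      (forall n, continuous (x n)) -> (forall n, x n u = c) ->
      (forall t x y x' y', `|F t x y - F t x' y'| <= L * (`|x - x'| + `|y - y'|)) ->
      (forall n t, 0 < t < u -> is_derive t 1 (x n.+1) (F t (a n t) (b n t))) ->
      `|x n.+2 t - x n.+1 t| <= A / 2 ^+ n.+1 * E t.
    move=> cx xu Fl dx; set A1 := A / _ in An0 Ehalf *.
    have -> : `|x n.+2 t - x n.+1 t| = `|(x n.+2 u - x n.+1 u) - (x n.+2 t - x n.+1 t)|.
      by rewrite !xu subrr sub0r normrN.
    apply: (@le_trans _ _ (- (A1 * E u) - - (A1 * E t))); last first.
      by rewrite opprK gerDr oppr_le0 mulr_ge0 // expR_ge0.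
    apply: (@growth_le R (fun t => x n.+2 t - x n.+1 t)
      (fun t => F t (a n.+1 t) (b n.+1 t) - F t (a n t) (b n t))
      (fun t => - (A1 * E t)) (fun t => 4 * L * A1 * E t)) => //.
    - by move=> s _; apply: cont_add; [|apply: cont_opp]; exact: cx.
    - by move=> s _; cont.
    - move=> s /andP[ts su]; have sU : 0 < s < u by rewrite (le_lt_trans t0 ts).
      by apply: der_add; [|apply: der_opp]; exact: dx.
    - by move=> s _; have d := dE s; deriv; ring.
    - move=> s /andP[ts su]; apply: le_trans (Fl _ _ _ _ _) _.
      have sI : 0 <= s <= u by rewrite (le_trans t0 (ltW ts)) ltW.
      have [h1 h2] := IH s sI.
      rewrite Ehalf in h1 h2.
      have -> : 4 * L * A1 * E s = L * (2 * A1 * E s + 2 * A1 * E s) by ring.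
      by rewrite ler_wpM2l // lerD.
  split.
    apply: (step2 a F1 a0 ca au) => [? ? ? ? ?|m s su]; first exact: (Flip _ _ _ _ _).1.
    by case: (st m) => _ _ /(_ s su) [].
  apply: (step2 b F2 b0 cb bu) => [? ? ? ? ?|m s su]; first exact: (Flip _ _ _ _ _).2.
  by case: (st m) => _ _ /(_ s su) [].
pose C := A * E 0.
have C0 : 0 <= C by rewrite mulr_ge0 // expR_ge0.
have key2 n t : `|a n.+1 (clamp 0 u t) - a n (clamp 0 u t)| <= C / 2 ^+ n /\
                `|b n.+1 (clamp 0 u t) - b n (clamp 0 u t)| <= C / 2 ^+ n.
  have tu := clamp_in t u0; have /andP[t0 _] := tu.
  have EE : A / 2 ^+ n * E (clamp 0 u t) <= C / 2 ^+ n.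
    rewrite /C mulrAC ler_wpM2r ?invr_ge0 ?exprn_ge0 // ler_wpM2l //.
    rewrite /E ler_expR ler_wpM2l ?mulr_ge0 //; lra.
  by have [h1 h2] := key n _ tu; split; [apply: le_trans h1 _|apply: le_trans h2 _].
have /choice[la laP] t : exists l, forall n, `|a n (clamp 0 u t) - l| <= 2 * C / 2 ^+ n.
  by apply: geo_lim => // n; exact: (key2 n t).1.
have /choice[lb lbP] t : exists l, forall n, `|b n (clamp 0 u t) - l| <= 2 * C / 2 ^+ n.
  by apply: geo_lim => // n; exact: (key2 n t).2.
have cla : continuous la.
  apply: unif_limit_cont => e e0; have [n hn] := geo_small (2 * C) e0.
  exists (fun t => a n (clamp 0 u t)); first by apply: cont_clamp => // x _; exact: ca.
  by move=> x; apply: le_trans (laP _ _) hn.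
have clb : continuous lb.
  apply: unif_limit_cont => e e0; have [n hn] := geo_small (2 * C) e0.
  exists (fun t => b n (clamp 0 u t)); first by apply: cont_clamp => // x _; exact: cb.
  by move=> x; apply: le_trans (lbP _ _) hn.
have lu (x : nat -> R -> R) (l : R -> R) c : (forall n, x n u = c) ->
  (forall t n, `|x n (clamp 0 u t) - l t| <= 2 * C / 2 ^+ n) -> l u = c.
  move=> xu xl; apply/eqP; rewrite -subr_eq0 -normr_eq0 eq_le normr_ge0 andbT.
  apply/ler_addgt0Pl => e e0; rewrite addr0; have [n hn] := geo_small (2 * C) e0.
  by have := xl u n; rewrite clamp_id ?u0 ?lexx // xu distrC => /le_trans; apply.
have sol (x : nat -> R -> R) (l : R -> R) (F : R -> R -> R -> R) :
    (forall n, continuous (x n)) ->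
    (forall t x y x' y', `|F t x y - F t x' y'| <= L * (`|x - x'| + `|y - y'|)) ->
    (forall a b : R -> R, continuous a -> continuous b -> continuous (fun t => F t (a t) (b t))) ->
    (forall n t, 0 < t < u -> is_derive t 1 (x n.+1) (F t (a n t) (b n t))) ->
    (forall t n, `|x n (clamp 0 u t) - l t| <= 2 * C / 2 ^+ n) ->
    forall t, 0 < t < u -> is_derive t 1 l (F t (la t) (lb t)).
  move=> cx Fl cF dx xl; apply: (@derive_unif_limit R l (fun t => F t (la t) (lb t))) => //.
    by move=> t _; exact: cF.
  move=> e e0.
  have [n hn] := geo_small ((2 * L + 1) * (2 * C)) e0.
  have C2 : 0 <= 2 * C / 2 ^+ n by apply: divr_ge0; [exact: mulr_ge0|exact: exprn_ge0].
  have hn' : (2 * L + 1) * (2 * C / 2 ^+ n) <= e by rewrite mulrA.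
  exists (x n.+1), (fun t => F t (a n t) (b n t)); split.
  - by move=> t _; exact: cx.
  - by move=> t tu; exact: dx.
  - move=> t tu; have := xl t n.+1; rewrite clamp_id // => /le_trans; apply.
    apply: le_trans hn'; apply: (@le_trans _ _ (1 * (2 * C / 2 ^+ n))); last first.
      by rewrite ler_wpM2r // lerDr mulr_ge0.
    have EE : 2 * C / 2 ^+ n = 2 * (2 * C / 2 ^+ n.+1).
      by rewrite exprS invfM !mulrA; field; rewrite expf_neq0.
    have : 0 <= 2 * C / 2 ^+ n.+1 by apply: divr_ge0; [exact: mulr_ge0|exact: exprn_ge0].
    lra.
  - move=> t /andP[t0 tu]; apply: le_trans (Fl _ _ _ _ _) _.
    have tu' : 0 <= t <= u by rewrite !ltW.
    have h1 := laP t n; have h2 := lbP t n; rewrite clamp_id // in h1 h2.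
    apply: le_trans hn'; apply: (@le_trans _ _ (L * (2 * C / 2 ^+ n + 2 * C / 2 ^+ n))).
      by rewrite ler_wpM2l // lerD.
    by lra.
exists la, lb; split => //.
- exact: (lu a).
- exact: (lu b).
move=> t tu; split.
  apply: (sol a) => // [? ? ? ? ?|x y cx cy|n s su].
  - exact: (Flip _ _ _ _ _).1.
  - exact: (Fc _ _ cx cy).1.
  - by case: (st n) => _ _ /(_ s su) [].
apply: (sol b) => // [? ? ? ? ?|x y cx cy|n s su].
- exact: (Flip _ _ _ _ _).2.
- exact: (Fc _ _ cx cy).2.
- by case: (st n) => _ _ /(_ s su) [].
Qed.

(** * The Loewner equation in real coordinates *)

(** Both quantities are coordinates of 1/z - 1/z', whose modulus is
    |z - z'| / (|z| |z'|), and |z|, |z'| >= m. *)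
Lemma inv_lip (R : realType) (p q p' q' m : R) : 0 < m -> m <= q -> m <= q' ->
  `|p / (p ^+ 2 + q ^+ 2) - p' / (p' ^+ 2 + q' ^+ 2)|
     <= (`|p - p'| + `|q - q'|) / m ^+ 2 /\
  `|q / (p ^+ 2 + q ^+ 2) - q' / (p' ^+ 2 + q' ^+ 2)|
     <= (`|p - p'| + `|q - q'|) / m ^+ 2.
Proof.
move=> m0 mq mq'.
have m20 : 0 < m ^+ 2 by rewrite exprn_gt0.
have n0 : m ^+ 2 <= p ^+ 2 + q ^+ 2.
  have : m ^+ 2 <= q ^+ 2 by rewrite lerXn2r ?nnegrE; lra.
  by have := sqr_ge0 p; lra.
have n0' : m ^+ 2 <= p' ^+ 2 + q' ^+ 2.
  have : m ^+ 2 <= q' ^+ 2 by rewrite lerXn2r ?nnegrE; lra.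
  by have := sqr_ge0 p'; lra.
have np : 0 < p ^+ 2 + q ^+ 2 by lra.
have np' : 0 < p' ^+ 2 + q' ^+ 2 by lra.
pose d : R := `|p - p'| + `|q - q'|; rewrite -/d.
have d0 : 0 <= d by rewrite addr_ge0.
have d2 : (p - p') ^+ 2 + (q - q') ^+ 2 <= d ^+ 2.
  have := mulr_ge0 (normr_ge0 (p - p')) (normr_ge0 (q - q')).
  rewrite -(real_normK (num_real (p - p'))) -(real_normK (num_real (q - q'))) /d.
  by move=> h; rewrite [leRHS]sqrrD lerD2r lerDl mulrn_wge0.
have E : (p / (p ^+ 2 + q ^+ 2) - p' / (p' ^+ 2 + q' ^+ 2)) ^+ 2 +
    (q / (p ^+ 2 + q ^+ 2) - q' / (p' ^+ 2 + q' ^+ 2)) ^+ 2 =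
    ((p - p') ^+ 2 + (q - q') ^+ 2) / ((p ^+ 2 + q ^+ 2) * (p' ^+ 2 + q' ^+ 2)).
  by field; rewrite !gt_eqF.
have B : ((p - p') ^+ 2 + (q - q') ^+ 2) /
    ((p ^+ 2 + q ^+ 2) * (p' ^+ 2 + q' ^+ 2)) <= (d / m ^+ 2) ^+ 2.
  rewrite expr_div_n; apply: ler_pM.
  - by rewrite addr_ge0 ?sqr_ge0.
  - by rewrite invr_ge0 mulr_ge0 // ltW.
  - exact: d2.
  - by rewrite lef_pV2 ?posrE ?exprn_gt0 ?mulr_gt0 // expr2 ler_pM // ltW.
rewrite -E in B.
have dm : 0 <= d / m ^+ 2 by rewrite divr_ge0 // ltW.
by split; rewrite -(ler_pXn2r (isT : (0 < 2)%N)) ?nnegrE // real_normK ?num_real //;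
  apply: le_trans B; rewrite ?lerDl ?lerDr sqr_ge0.
Qed.

Lemma inv_bound (R : realType) (p q m : R) : 0 < m -> m <= q ->
  `|p / (p ^+ 2 + q ^+ 2)| <= m^-1 /\ `|q / (p ^+ 2 + q ^+ 2)| <= m^-1.
Proof.
move=> m0 mq; have q0 : 0 < q by lra.
have np : 0 < p ^+ 2 + q ^+ 2 by have := sqr_ge0 p; have := exprn_gt0 2 q0; lra.
have h : m * q <= p ^+ 2 + q ^+ 2.
  have : m * q <= q ^+ 2 by rewrite expr2 ler_pM2r.
  by have := sqr_ge0 p; lra.
have h2 : m * `|p| <= p ^+ 2 + q ^+ 2.
  have : m * `|p| <= q * `|p| by rewrite ler_wpM2r.
  rewrite -(@real_normK _ p) ?num_real //.
  have := sqr_ge0 (`|p| - q); have := sqr_ge0 `|p|; have := sqr_ge0 q; nra.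
split; rewrite normrM normfV (gtr0_norm np) ler_pdivrMr // mulrC ler_pdivlMr // mulrC //.
by rewrite gtr0_norm.
Qed.

(** The coordinates (a, b) of g_t(z), with the driving function l, on the
    open interval; continuity is demanded on the whole line, which the
    extension by [clamp] provides. *)
Definition flow (R : realType) (l a b : R -> R) (u : R) :=
  [/\ continuous a, continuous b & forall t, 0 < t < u ->
   is_derive t 1 a (2 * ((a t - l t) / ((a t - l t) ^+ 2 + b t ^+ 2))) /\
   is_derive t 1 b (- (2 * (b t / ((a t - l t) ^+ 2 + b t ^+ 2))))].

(** Followed backwards from time u the height b increases, so the equation
    may be modified below height y without changing this solution.  The
    modified right-hand side is bounded and Lipschitz. *)
Lemma flow_exists (R : realType) (l : R -> R) (u x y : R) :
  continuous l -> 0 <= u -> 0 < y ->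
  exists a b, [/\ flow l a b u, a u = x, b u = y &
                  forall t, 0 <= t <= u -> y <= b t].
Proof.
(* the height is cut off below at y *)
move=> cl u0 y0; pose m z : R := Num.max y z.
have ym z : y <= m z by rewrite /m le_max lexx.
have mlip z z' : `|m z - m z'| <= `|z - z'|.
  rewrite /m !maxEle; case: (leP y z); case: (leP y z') => // h1 h2.
  - have : z - y <= z - z' by lra.
    by rewrite !ger0_norm; lra.
  - by rewrite !ler0_norm; lra.
  - by rewrite subrr normr0.
have pos (t z w : R) : 0 < (w - l t) ^+ 2 + m z ^+ 2.
  have := sqr_ge0 (w - l t); have : 0 < m z ^+ 2.
    by rewrite exprn_gt0 // (lt_le_trans y0).
  lra.
pose F1 t z w : R := 2 * ((z - l t) / ((z - l t) ^+ 2 + m w ^+ 2)).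
pose F2 t z w : R := - (2 * (m w / ((z - l t) ^+ 2 + m w ^+ 2))).
have L0 : 0 <= 2 / y ^+ 2 by rewrite divr_ge0 // sqr_ge0.
have [a [b [[ca cb] au bu dab]]] : exists a b : R -> R,
    [/\ continuous a /\ continuous b, a u = x, b u = y &
    forall t, 0 < t < u -> is_derive t 1 a (F1 t (a t) (b t)) /\
                           is_derive t 1 b (F2 t (a t) (b t))].
  apply: (@picard R F1 F2 (2 / y ^+ 2) (2 / y)) => //.
  - move=> a b ca cb.
    have cm : continuous (fun t => m (b t)).
      by apply: cont_all => t; apply: cont_max; [exact: cont_cst|exact: cb].
    have cN : continuous (fun t => ((a t - l t) ^+ 2 + m (b t) ^+ 2)^-1).
      apply: cont_all => t; apply: cont_inv; last by cont.
      by rewrite gt_eqF.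
    by split; apply: cont_all => t; rewrite /F1 /F2; cont; rewrite ?gt_eqF.
  - move=> t z w z' w'.
    have [h1 h2] := inv_lip (z - l t) (z' - l t) y0 (ym w) (ym w').
    have e : z - l t - (z' - l t) = z - z' by ring.
    have h3 : (`|z - z'| + `|m w - m w'|) / y ^+ 2 <= (`|z - z'| + `|w - w'|) / y ^+ 2.
      by rewrite ler_wpM2r ?invr_ge0 ?sqr_ge0 // lerD2l.
    rewrite e in h1 h2.
    have N2 (A B D : R) : `|A - B| <= D -> `|2 * A - 2 * B| <= 2 * D.
      by rewrite -mulrBr normrM ger0_norm // ler_pM2l.
    have -> : 2 / y ^+ 2 * (`|z - z'| + `|w - w'|) =
      2 * ((`|z - z'| + `|w - w'|) / y ^+ 2) by ring.
    split; first exact/N2/(le_trans h1).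
    rewrite /F2 -opprD normrN; exact/N2/(le_trans h2).
  - move=> t z w; have [h1 h2] := inv_bound (z - l t) y0 (ym w).
    by split; rewrite /F1 /F2 ?normrN normrM ger0_norm // ler_pM2l.
have by_ t : 0 <= t <= u -> y <= b t.
  move=> /andP[t0 tu]; rewrite -bu.
  apply: (@nonincr R b (fun t => F2 t (a t) (b t))) => //.
  - by move=> s _; exact: cb.
  - by move=> s /andP[ts su]; have [] := dab s; rewrite ?su ?(le_lt_trans t0 ts).
  - move=> s _; rewrite /F2 oppr_le0 mulr_ge0 // divr_ge0 ?(ltW (pos _ _ _)) //.
    by rewrite ltW // (lt_le_trans y0).
exists a, b; split => //; split => // t tu.
have [d1 d2] := dab t tu; have e : m (b t) = b t.
  by rewrite /m max_r // by_ //; case/andP: tu => *; rewrite !ltW.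
by rewrite /F1 /F2 e in d1 d2.
Qed.

(** * The barrier and its consequences for one flow *)

(** An increasing driving function l with derivatives l1 and l2 and Loewner
    curvature at least 9. *)
Definition driving (R : realType) (T : R) (l l1 l2 : R -> R) :=
  [/\ continuous l, forall t, t < T -> {for t, continuous l1},
      forall t, 0 < t < T -> is_derive t 1 l (l1 t) /\ is_derive t 1 l1 (l2 t),
      forall t, 0 <= t < T -> 0 < l1 t &
      forall t, 0 < t < T -> 0 <= l2 t /\ 9 * l2 t <= l1 t ^+ 3].

(** A flow that is regular up to time u and ends there on the barrier circle
    l1 |Z|^2 = 6 Re Z.  Ending on the circle, rather than straight above the
    singularity, makes Re (1/Z) maximal at time u, as [traj_order] needs. *)
Definition traj (R : realType) (l l1 : R -> R) (u : R) (a b : R -> R) :=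
  [/\ flow l a b u, forall t, 0 <= t <= u -> 0 < b t, l u < a u &
      l1 u * ((a u - l u) ^+ 2 + b u ^+ 2) = 6 * (a u - l u)].

Definition offset (R : realType) (l a : R -> R) (t : R) : R := a t - l t.

Definition dist2 (R : realType) (l a b : R -> R) (t : R) : R :=
  offset l a t ^+ 2 + b t ^+ 2.

Lemma itv_oo_subl (R : realType) (s t u : R) : 0 <= t -> t < s < u -> 0 < s < u.
Proof. by move=> t0 /andP[ts ->]; rewrite (le_lt_trans t0). Qed.

Lemma norm2_gt0 (R : realType) (x y : R) : 0 < y -> 0 < x ^+ 2 + y ^+ 2.
Proof. by move=> y0; have := sqr_ge0 x; have := exprn_gt0 2 y0; lra. Qed.

Lemma driving_l1_mono (R : realType) (T : R) (l l1 l2 : R -> R) : driving T l l1 l2 ->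
  forall s t, 0 <= s -> s <= t -> t < T -> l1 s <= l1 t.
Proof.
move=> [_ cl1 dl _ l2P] s t s0 st tT.
apply: (@nondecr R l1 l2) => //.
- by move=> x /andP[_ xt]; apply: cl1; lra.
- by move=> x /(itv_oo_subl s0)/andP[x0 xt]; apply: (dl _ _).2; rewrite x0 (lt_trans xt).
- by move=> x /(itv_oo_subl s0)/andP[x0 xt]; apply: (l2P _ _).1; rewrite x0 (lt_trans xt).
Qed.

Lemma driving_l_mono (R : realType) (T : R) (l l1 l2 : R -> R) : driving T l l1 l2 ->
  forall s t, 0 <= s -> s <= t -> t <= T -> l s <= l t.
Proof.
move=> [cl _ dl l10 _] s t s0 st tT.
apply: (@nondecr R l l1) => //.
- by move=> x _; exact: cl.
- by move=> x /(itv_oo_subl s0)/andP[x0 xt]; apply: (dl _ _).1; rewrite x0 (lt_le_trans xt).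
- by move=> x /(itv_oo_subl s0)/andP[x0 xt]; apply/ltW/l10; rewrite (ltW x0) (lt_le_trans xt).
Qed.

Section Traj.
Variables (R : realType) (T : R) (l l1 l2 : R -> R) (dr : driving T l l1 l2).
Variables (u : R) (a b : R -> R) (uT : u < T) (u0 : 0 <= u) (tr : traj l l1 u a b).
Local Notation X := (offset l a).
Local Notation N := (dist2 l a b).

Lemma traj_cont_a : continuous a.
Proof. by case: tr => [[]]. Qed.
Lemma traj_cont_b : continuous b.
Proof. by case: tr => [[]]. Qed.
Let ca : continuous a := traj_cont_a.
Let cb : continuous b := traj_cont_b.
Let cl : continuous l. Proof. by case: dr. Qed.
Lemma traj_cont_offset : continuous X.
Proof. by apply: cont_all => t; rewrite /offset; cont. Qed.
Let cX : continuous X := traj_cont_offset.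
Lemma traj_cont_dist2 : continuous N.
Proof. by apply: cont_all => t; rewrite /dist2; cont. Qed.
Let cN : continuous N := traj_cont_dist2.
Let cl1 t : t <= u -> {for t, continuous l1}.
Proof. by case: dr => _ h _ _ _ tu; apply: h; exact: le_lt_trans tu uT. Qed.
Lemma traj_b_gt0 t : 0 <= t <= u -> 0 < b t.
Proof. by case: tr => _ h _ _; exact: h. Qed.
Lemma traj_dist2_gt0 t : 0 <= t <= u -> 0 < N t.
Proof. by move=> tu; apply/norm2_gt0/traj_b_gt0. Qed.
Let l10 t : 0 <= t <= u -> 0 < l1 t.
Proof.
by case: dr => _ _ _ h _ /andP[t0 tu]; apply: h; rewrite t0 (le_lt_trans tu).
Qed.
Let inT t : 0 < t < u -> 0 < t < T.
Proof. by move=> /andP[-> tu]; exact: lt_trans tu uT. Qed.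
Let incc t : 0 < t < u -> 0 <= t <= u.
Proof. by move=> /andP[t0 tu]; rewrite !ltW. Qed.
Lemma traj_der_a t : 0 < t < u -> is_derive t 1 a (2 * (X t / N t)).
Proof. by case: tr => [[_ _ h] _ _ _] tu; exact: (h _ tu).1. Qed.
Lemma traj_der_b t : 0 < t < u -> is_derive t 1 b (- (2 * (b t / N t))).
Proof. by case: tr => [[_ _ h] _ _ _] tu; exact: (h _ tu).2. Qed.
Let dl t : 0 < t < u -> is_derive t 1 l (l1 t).
Proof. by case: dr => _ _ h _ _ /inT tu; exact: (h _ tu).1. Qed.
Let dl1 t : 0 < t < u -> is_derive t 1 l1 (l2 t).
Proof. by case: dr => _ _ h _ _ /inT tu; exact: (h _ tu).2. Qed.
Lemma traj_der_offset t : 0 < t < u -> is_derive t 1 X (2 * (X t / N t) - l1 t).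
Proof. by move=> tu; have d1 := traj_der_a tu; have d2 := dl tu; exact: der_add d1 (der_opp d2). Qed.
Lemma traj_der_dist2 t : 0 < t < u ->
  is_derive t 1 N (8 * (X t ^+ 2 / N t) - 4 - 2 * l1 t * X t).
Proof.
move=> tu; have d1 := traj_der_offset tu; have d2 := traj_der_b tu.
have n0 : N t != 0 by rewrite gt_eqF // traj_dist2_gt0 // incc.
apply: (der_eq (der_add (der_sq d1) (der_sq d2))).
have e : b t ^+ 2 = N t - X t ^+ 2 by rewrite /dist2; ring.
have -> : 2 * b t * - (2 * (b t / N t)) = - (4 * (b t ^+ 2 / N t)) by ring.
by rewrite e; field.
Qed.

(** (X Y)' = - l1 Y: multiplying by the height removes the singular term of
    X'. *)
Lemma traj_offset_gt0 t : 0 <= t <= u -> 0 < X t.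
Proof.
move=> tu; have /andP[t0 tu'] := tu.
have h : X u * b u <= X t * b t.
  apply: (@nonincr R (fun t => X t * b t) (fun t => - (l1 t * b t))) => //.
  - by move=> s _; cont.
  - move=> s /(itv_oo_subl t0) su; have d1 := traj_der_offset su; have d2 := traj_der_b su.
    by deriv; ring.
  - move=> s /(itv_oo_subl t0) su; rewrite oppr_le0 mulr_ge0 // ltW ?traj_b_gt0 ?l10 ?incc //.
have : 0 < X t * b t.
  apply: lt_le_trans h; apply: mulr_gt0; last by rewrite traj_b_gt0 // u0 lexx.
  by case: tr => _ _ h _; rewrite /offset; lra.
by rewrite pmulr_lgt0 // traj_b_gt0.
Qed.

(** The barrier.  For Q = l1 N - 6 X one finds
    k Q - Q' = N (l1^3 / 9 - l2) with
    k = 2/N - 4 l1 X / (3N) + l1^2 / 9, and this is nonnegative precisely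
    when the curvature is at least 9. *)
Lemma traj_barrier t : 0 <= t <= u -> 6 * X t <= l1 t * N t.
Proof.
move=> tu; have /andP[t0 tu'] := tu.
rewrite -subr_ge0.
apply: (@gronwall_ge0 R (fun t => l1 t * N t - 6 * X t)
  (fun t => (l2 t * N t + l1 t * (8 * (X t ^+ 2 / N t) - 4 - 2 * l1 t * X t))
     - 6 * (2 * (X t / N t) - l1 t))
  (fun t => 2 * (N t)^-1 - 4 / 3 * l1 t * X t * (N t)^-1 + l1 t ^+ 2 * 9^-1) t u) => //.
- by move=> x /andP[tx xu]; have c := cl1 xu; cont.
- move=> x /(itv_oo_subl t0) xu; have d1 := traj_der_offset xu; have d2 := traj_der_dist2 xu; have d3 := dl1 xu.
  by deriv; ring.
- move=> x /andP[tx xu]; have c := cl1 xu; cont.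
  + by rewrite gt_eqF // traj_dist2_gt0 // xu (le_trans t0).
  + by rewrite gt_eqF // traj_dist2_gt0 // xu (le_trans t0).
- move=> x /(itv_oo_subl t0) xu.
  have n0 := traj_dist2_gt0 (incc xu); have n0' : N x != 0 by rewrite gt_eqF.
  have [_ h2] : 0 <= l2 x /\ 9 * l2 x <= l1 x ^+ 3.
    by case: dr => _ _ _ _; apply; exact: inT.
  rewrite -subr_ge0.
  have -> : (2 * (N x)^-1 - 4 / 3 * l1 x * X x * (N x)^-1 + l1 x ^+ 2 / 9) *
     (l1 x * N x - 6 * X x) - (l2 x * N x + l1 x * (8 * (X x ^+ 2 / N x) - 4 -
     2 * l1 x * X x) - 6 * (2 * (X x / N x) - l1 x)) = N x * (l1 x ^+ 3 / 9 - l2 x).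
    by field.
  by rewrite mulr_ge0 ?(ltW n0) //; lra.
- by case: tr => _ _ _ e; rewrite /dist2 /offset e subrr.
Qed.

Lemma traj_a_mono t : 0 <= t <= u -> a t <= a u.
Proof.
move=> tu; have /andP[t0 tu'] := tu.
apply: (@nondecr R a (fun t => 2 * (X t / N t))) => //.
- by move=> x _; exact: traj_cont_a.
- by move=> x /(itv_oo_subl t0) xu; exact: traj_der_a.
- move=> x /(itv_oo_subl t0)/incc xu; rewrite mulr_ge0 // divr_ge0 // ltW //.
    exact: traj_offset_gt0.
  exact: traj_dist2_gt0.
Qed.

Lemma traj_b_mono s t : 0 <= s -> s <= t -> t <= u -> b t <= b s.
Proof.
move=> s0 st tu.
apply: (@nonincr R b (fun t => - (2 * (b t / N t)))) => //.
- by move=> x _; exact: traj_cont_b.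
- by move=> x /(itv_oo_subl s0)/andP[x0 xt]; apply: traj_der_b; rewrite x0 (lt_le_trans xt).
- move=> x /(itv_oo_subl s0)/andP[x0 xt]; have xu : 0 <= x <= u.
    by rewrite ltW // ltW // (lt_le_trans xt).
  by rewrite oppr_le0 mulr_ge0 // divr_ge0 // ltW ?traj_dist2_gt0 ?traj_b_gt0.
Qed.

(** (Y^2)' = - 4 Y^2 / N >= -4. *)
Lemma traj_b2_le t : 0 <= t <= u -> b t ^+ 2 <= b u ^+ 2 + 4 * (u - t).
Proof.
move=> tu; have /andP[t0 tu'] := tu.
have : b t ^+ 2 + 4 * t <= b u ^+ 2 + 4 * u.
  apply: (@nondecr R (fun t => b t ^+ 2 + 4 * t)
    (fun t => 4 - 4 * (b t ^+ 2 / N t))) => //.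
  - by move=> x _; cont.
  - by move=> x /(itv_oo_subl t0) xu; have d := traj_der_b xu; deriv; ring.
  - move=> x /(itv_oo_subl t0)/incc xu; rewrite subr_ge0 -[leRHS]mulr1 ler_pM2l //.
    by rewrite ler_pdivrMr ?traj_dist2_gt0 // mul1r /dist2 lerDr sqr_ge0.
lra.
Qed.

(** Near the singularity the flow is almost vertical: by the barrier
    (Y^2)' = -4 + 4 X^2 / N <= -4 + 2 l1 X / 3.  This is the lower bound
    on Y that survives the passage to the limit of singular flows. *)
Lemma traj_b2_ge t : 0 <= t <= u ->
  (forall s, t <= s <= u -> l1 s * X s <= 3) -> 2 * (u - t) <= b t ^+ 2.
Proof.
move=> tu H; have /andP[t0 tu'] := tu.
have : b u ^+ 2 + 2 * u <= b t ^+ 2 + 2 * t.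
  apply: (@nonincr R (fun t => b t ^+ 2 + 2 * t)
    (fun t => 2 - 4 * (b t ^+ 2 / N t))) => //.
  - by move=> x _; cont.
  - by move=> x /(itv_oo_subl t0) xu; have d := traj_der_b xu; deriv; ring.
  - move=> x xtu; have xu := itv_oo_subl t0 xtu; have xu' := incc xu.
    have n0 := traj_dist2_gt0 xu'.
    have h1 := traj_barrier xu'; have h2 := traj_offset_gt0 xu'.
    have h3 : l1 x * X x <= 3 by apply: H; case/andP: xtu => *; rewrite !ltW.
    rewrite subr_le0 mulrA ler_pdivlMr // /dist2.
    have : 6 * X x * X x <= l1 x * N x * X x by rewrite ler_pM2r.
    have : l1 x * X x * N x <= 3 * N x by rewrite ler_pM2r.
    by rewrite /dist2; nra.
by have := sqr_ge0 (b u); lra.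
Qed.

(** The barrier gives (X/Y)' = (4 X - l1 N) / (N Y) <= - l1 / (3 Y), and
    [traj_b2_le] with the hypotheses gives 2 Y <= l T - l t; hence X/Y
    decreases at least as fast as 2/3 ln (l T - l t). *)
Lemma traj_height : (forall t, 0 <= t <= u ->
    0 < l T - l t /\ 16 * (T - t) <= (l T - l t) ^+ 2) ->
  b u ^+ 2 <= 4 * (T - u) ->
  2 / 3 * (ln (l T - l 0) - ln (l T - l u)) <= X 0 / b 0.
Proof.
move=> HG bu.
have h : X u / b u - 2 / 3 * ln (l T - l u) <= X 0 / b 0 - 2 / 3 * ln (l T - l 0).
  apply: (@nonincr R (fun t => X t * (b t)^-1 - 2 / 3 * ln (l T - l t))
   (fun t => ((2 * (X t / N t) - l1 t) * (b t)^-1 + 2 * X t / (N t * b t)) +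
        2 / 3 * ((l T - l t)^-1 * l1 t))) => //.
  - move=> x xu; have [g0 _] := HG x xu; have bx := traj_b_gt0 xu; cont => //.
    by rewrite gt_eqF.
  - move=> x xu; have bx := traj_b_gt0 (incc xu); have bx' : b x != 0 by rewrite gt_eqF.
    have n0 := traj_dist2_gt0 (incc xu); have n0' : N x != 0 by rewrite gt_eqF.
    have [g0 _] := HG x (incc xu); have g0' : l T - l x != 0 by rewrite gt_eqF.
    have d1 := traj_der_offset xu; have d2 := traj_der_b xu; have d3 := dl xu.
    by deriv; field; rewrite n0' bx' g0'.
  - move=> x xu; have xu' := incc xu; have bx := traj_b_gt0 xu'.
    have n0 := traj_dist2_gt0 xu'; have l1x := l10 xu'.
    have [g0 g2] := HG x xu'.
    have h1 := traj_barrier xu'.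
    have h2 : 2 * b x <= l T - l x.
      rewrite -(ler_pXn2r (isT : (0 < 2)%N)) ?nnegrE; try lra.
      by have := traj_b2_le xu'; rewrite exprMn; lra.
    have e1 : (2 * (X x / N x) - l1 x) / b x + 2 * X x / (N x * b x) =
       (4 * X x - l1 x * N x) / (N x * b x).
      by field; rewrite !gt_eqF.
    (* the barrier: 4 X <= 2/3 l1 N *)
    have e2 : (4 * X x - l1 x * N x) / (N x * b x) <= - (l1 x / (3 * b x)).
      rewrite ler_pdivrMr ?mulr_gt0 //.
      have -> : - (l1 x / (3 * b x)) * (N x * b x) = - (l1 x * N x) / 3.
        by field; rewrite gt_eqF.
      by lra.
    have e3 : 2 / 3 * ((l T - l x)^-1 * l1 x) <= l1 x / (3 * b x).
      have -> : 2 / 3 * ((l T - l x)^-1 * l1 x) = l1 x * (2 / (3 * (l T - l x))).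
        by field; rewrite gt_eqF.
      rewrite ler_pM2l // ler_pdivrMr ?mulr_gt0 // mulrC ler_pdivlMr ?mulr_gt0 //.
      lra.
    lra.
have uu : 0 <= u <= u by rewrite u0 lexx.
have : 0 <= X u / b u by rewrite divr_ge0 // ltW ?traj_offset_gt0 ?traj_b_gt0.
lra.
Qed.

End Traj.

(** * Comparison of two flows *)

(** With 1/Z = r - iv, the real part of (1/Z)' = - 2/Z^3 + l1/Z^2. *)
Lemma traj_der_re_inv (R : realType) (T : R) (l l1 l2 : R -> R) (u : R) (a b : R -> R) :
  driving T l l1 l2 -> u < T -> 0 <= u -> traj l l1 u a b ->
  forall t, 0 < t < u ->
  let r := offset l a t / dist2 l a b t in let v := b t / dist2 l a b t in
  is_derive t 1 (fun t => offset l a t * (dist2 l a b t)^-1)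
    (v ^+ 2 * (6 * r - l1 t) + r ^+ 2 * (l1 t - 2 * r)).
Proof.
move=> dr uT u0 tr t tu r v.
have d1 := traj_der_offset dr uT tr tu; have d2 := traj_der_dist2 dr uT tr tu.
have tu' : 0 <= t <= u by case/andP: tu => *; rewrite !ltW.
have n0 : dist2 l a b t != 0 by rewrite gt_eqF // (traj_dist2_gt0 tr).
have e : b t ^+ 2 = dist2 l a b t - offset l a t ^+ 2 by rewrite /dist2; ring.
by deriv; rewrite /v expr_div_n e /r; field.
Qed.

(** The barrier, read as a bound on Re (1/Z). *)
Lemma traj_re_inv (R : realType) (T : R) (l l1 l2 : R -> R) (u : R) (a b : R -> R) :
  driving T l l1 l2 -> u < T -> 0 <= u -> traj l l1 u a b ->
  forall t, 0 <= t <= u ->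
  0 < offset l a t / dist2 l a b t <= l1 t / 6.
Proof.
move=> dr uT u0 tr t tu; have n0 := traj_dist2_gt0 tr tu.
rewrite divr_gt0 ?(traj_offset_gt0 dr uT u0 tr) //= ler_pdivrMr //.
by have := traj_barrier dr uT tr tu; lra.
Qed.

(** The squared distance E satisfies E' = - 4 Re (1/(Z Z')) E, and the barrier
    bounds Re (1/(Z Z')) by l1^2 / 36.  The bound does not degenerate as the
    endpoints approach the singularity. *)
Lemma traj_close (R : realType) (T : R) (l l1 l2 : R -> R) (u : R)
    (a b a' b' : R -> R) :
  driving T l l1 l2 -> u < T -> 0 <= u -> traj l l1 u a b -> traj l l1 u a' b' ->
  forall t, 0 <= t <= u ->
  (a t - a' t) ^+ 2 + (b t - b' t) ^+ 2 <=
    ((a u - a' u) ^+ 2 + (b u - b' u) ^+ 2) * expR (l1 u ^+ 2 / 9 * (u - t)).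
Proof.
move=> dr uT u0 tr tr' t tu; have /andP[t0 tu'] := tu.
set C := l1 u ^+ 2 / 9.
pose E t := (a t - a' t) ^+ 2 + (b t - b' t) ^+ 2.
have ca := traj_cont_a tr; have cb := traj_cont_b tr.
have ca' := traj_cont_a tr'; have cb' := traj_cont_b tr'.
have h : E t * expR (C * t) <= E u * expR (C * u).
  apply: (@nondecr R
   (fun t => ((a t - a' t) ^+ 2 + (b t - b' t) ^+ 2) * expR (C * t))
   (fun t => (C - 4 * ((offset l a t / dist2 l a b t) * (offset l a' t / dist2 l a' b' t)
      - (b t / dist2 l a b t) * (b' t / dist2 l a' b' t))) * E t * expR (C * t))) => //.
  - by move=> x _; cont.
  - move=> x /(itv_oo_subl t0) xu.
    have d1 := traj_der_a tr xu; have d2 := traj_der_b tr xu.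
    have d3 := traj_der_a tr' xu; have d4 := traj_der_b tr' xu.
    have xu' : 0 <= x <= u by case/andP: xu => *; rewrite !ltW.
    have n0 := traj_dist2_gt0 tr xu'; have n0' := traj_dist2_gt0 tr' xu'.
    deriv; rewrite /E.
    have -> : a x = offset l a x + l x by rewrite /offset; ring.
    have -> : a' x = offset l a' x + l x by rewrite /offset; ring.
    move: n0 n0'; rewrite /dist2; move: (offset l a x) (offset l a' x) (b x) (b' x).
    by move=> x1 x2 y1 y2 n0 n0'; field; rewrite !gt_eqF.
  - move=> x /(itv_oo_subl t0) xu.
    have xu' : 0 <= x <= u by case/andP: xu => *; rewrite !ltW.
    have n0 := traj_dist2_gt0 tr xu'; have n0' := traj_dist2_gt0 tr' xu'.
    rewrite mulr_ge0 ?expR_ge0 // mulr_ge0 //; last by rewrite addr_ge0 ?sqr_ge0.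
    have /andP[p1 r1] := traj_re_inv dr uT u0 tr xu'.
    have /andP[p2 r2] := traj_re_inv dr uT u0 tr' xu'.
    have l1u : l1 x <= l1 u by case/andP: xu' => x0 xu1; apply: (driving_l1_mono dr).
    have {}r1 : offset l a x / dist2 l a b x <= l1 u / 6 by lra.
    have {}r2 : offset l a' x / dist2 l a' b' x <= l1 u / 6 by lra.
    have y1 : 0 <= b x / dist2 l a b x by rewrite divr_ge0 // ltW // (traj_b_gt0 tr).
    have y2 : 0 <= b' x / dist2 l a' b' x by rewrite divr_ge0 // ltW // (traj_b_gt0 tr').
    have := ler_pM (ltW p1) (ltW p2) r1 r2.
    have := mulr_ge0 y1 y2.
    rewrite /C; lra.
have -> : C * (u - t) = C * u - C * t by ring.
rewrite expRD expRN mulrA ler_pdivlMr ?expR_gt0 //.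
Qed.

(** For z_j = r_j - i v_j = 1/Z_j, the real part of
    (z_1 - z_2)' = w (z_1 - z_2), w = - 2 (z_1^2 + z_1 z_2 + z_2^2) + m (z_1 + z_2),
    in which Im (z_1 - z_2) has been eliminated in favour of Re (Z_2 - Z_1).
    Here q = Im w. *)
Lemma tip_algebra (R : realType) (m r1 v1 r2 v2 : R) :
  let j := r1 * v2 + r2 * v1 in j != 0 ->
  let q := v1 * (4 * r1 + 2 * r2 - m) + v2 * (2 * r1 + 4 * r2 - m) in
  let k := - 2 * (r1 ^+ 2 - v1 ^+ 2 + r1 * r2 - v1 * v2 + r2 ^+ 2 - v2 ^+ 2)
     + m * (r1 + r2) - q * (r1 * r2 - v1 * v2) / j in
  v1 ^+ 2 * (6 * r1 - m) + r1 ^+ 2 * (m - 2 * r1)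
    - (v2 ^+ 2 * (6 * r2 - m) + r2 ^+ 2 * (m - 2 * r2)) - k * (r1 - r2) =
  q * (r2 * (r1 ^+ 2 + v1 ^+ 2) - r1 * (r2 ^+ 2 + v2 ^+ 2)) / j.
Proof. by move=> j j0 q k; rewrite /k /q /j; field. Qed.

(** The real part of the tip is monotone in time.  Backwards in time
    (A, B) = (X2 - X1, Re (1/Z1 - 1/Z2)) solves a linear system whose
    off-diagonal coefficients are nonnegative.  For such a system the
    product A B satisfies a linear differential inequality that keeps it
    nonnegative; then (A^2)' = - 4 A B <= 0 prevents A from reaching 0. *)
Lemma traj_order (R : realType) (T : R) (l l1 l2 : R -> R) (u1 u2 : R)
    (a1 b1 a2 b2 : R -> R) :
  driving T l l1 l2 -> 0 <= u1 -> u1 <= u2 -> u2 < T ->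
  traj l l1 u1 a1 b1 -> traj l l1 u2 a2 b2 ->
  a1 u1 < a2 u1 -> a1 0 < a2 0.
Proof.
move=> dr u10 u12 u2T tr1 tr2 au.
have u20 := le_trans u10 u12; have u1T := le_lt_trans u12 u2T.
have in2 t : 0 <= t <= u1 -> 0 <= t <= u2.
  by move=> /andP[-> tu]; exact: le_trans u12.
have in2' t : 0 < t < u1 -> 0 < t < u2.
  by move=> /andP[-> tu]; exact: lt_le_trans u12.
have incc t : 0 < t < u1 -> 0 <= t <= u1 by move=> /andP[*]; rewrite !ltW.
have ca1 := traj_cont_a tr1; have cb1 := traj_cont_b tr1.
have ca2 := traj_cont_a tr2; have cb2 := traj_cont_b tr2.
have cX1 : continuous (offset l a1) := traj_cont_offset dr tr1.
have cX2 : continuous (offset l a2) := traj_cont_offset dr tr2.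
have cN1 : continuous (dist2 l a1 b1) := traj_cont_dist2 dr tr1.
have cN2 : continuous (dist2 l a2 b2) := traj_cont_dist2 dr tr2.
pose X1 := offset l a1; pose X2 := offset l a2.
pose N1 := dist2 l a1 b1; pose N2 := dist2 l a2 b2.
pose r1 t := X1 t * (N1 t)^-1; pose r2 t := X2 t * (N2 t)^-1.
pose v1 t := b1 t * (N1 t)^-1; pose v2 t := b2 t * (N2 t)^-1.
pose A t := a2 t - a1 t; pose B t := r1 t - r2 t.
pose j t := r1 t * v2 t + r2 t * v1 t.
pose q t := v1 t * (4 * r1 t + 2 * r2 t - l1 t) + v2 t * (2 * r1 t + 4 * r2 t - l1 t).
pose k t := - 2 * (r1 t ^+ 2 - v1 t ^+ 2 + r1 t * r2 t - v1 t * v2 t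
     + r2 t ^+ 2 - v2 t ^+ 2)
     + l1 t * (r1 t + r2 t) - q t * (r1 t * r2 t - v1 t * v2 t) / j t.
have n1 t : 0 <= t <= u1 -> 0 < N1 t by move=> tu; exact: (traj_dist2_gt0 tr1).
have n2 t : 0 <= t <= u1 -> 0 < N2 t by move=> /in2 tu; exact: (traj_dist2_gt0 tr2).
have n1' t : 0 <= t <= u1 -> N1 t != 0 by move=> /n1 h; rewrite gt_eqF.
have n2' t : 0 <= t <= u1 -> N2 t != 0 by move=> /n2 h; rewrite gt_eqF.
have cr1 t : 0 <= t <= u1 -> {for t, continuous r1}.
  by move=> tu; have h := n1' t tu; rewrite /r1; cont.
have cr2 t : 0 <= t <= u1 -> {for t, continuous r2}.
  by move=> tu; have h := n2' t tu; rewrite /r2; cont.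
have cv1 t : 0 <= t <= u1 -> {for t, continuous v1}.
  by move=> tu; have h := n1' t tu; rewrite /v1; cont.
have cv2 t : 0 <= t <= u1 -> {for t, continuous v2}.
  by move=> tu; have h := n2' t tu; rewrite /v2; cont.
have r1p t : 0 <= t <= u1 -> 0 < r1 t.
  by move=> tu; have /andP[] := traj_re_inv dr u1T u10 tr1 tu.
have r2p t : 0 <= t <= u1 -> 0 < r2 t.
  by move=> tu; have /andP[] := traj_re_inv dr u2T u20 tr2 (in2 _ tu).
have v1p t : 0 <= t <= u1 -> 0 < v1 t.
  by move=> tu; rewrite divr_gt0 ?n1 // (traj_b_gt0 tr1).
have v2p t : 0 <= t <= u1 -> 0 < v2 t.
  by move=> tu; rewrite divr_gt0 ?n2 // (traj_b_gt0 tr2) ?in2.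
have r1l t : 0 <= t <= u1 -> r1 t <= l1 t / 6.
  by move=> tu; have /andP[] := traj_re_inv dr u1T u10 tr1 tu.
have r2l t : 0 <= t <= u1 -> r2 t <= l1 t / 6.
  by move=> tu; have /andP[] := traj_re_inv dr u2T u20 tr2 (in2 _ tu).
have jp t : 0 <= t <= u1 -> 0 < j t.
  by move=> tu; rewrite addr_gt0 // mulr_gt0 ?r1p ?r2p ?v1p ?v2p.
have dA t : 0 < t < u1 -> is_derive t 1 A (- (2 * B t)).
  move=> tu; have d1 := traj_der_a tr1 tu; have d2 := traj_der_a tr2 (in2' _ tu).
  rewrite /A; deriv.
  by rewrite /B /r1 /r2 /X1 /X2 /N1 /N2; ring.
have cA : continuous A by apply: cont_all => t; rewrite /A; cont.
have AB t : 0 <= t <= u1 -> 0 <= A t * B t.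
  move=> tu; have /andP[t0 tu1] := tu.
  apply: (@gronwall_ge0 R (fun t => A t * B t)
   (fun t => - (2 * B t) * B t + A t *
     ((v1 t ^+ 2 * (6 * r1 t - l1 t) + r1 t ^+ 2 * (l1 t - 2 * r1 t)) -
      (v2 t ^+ 2 * (6 * r2 t - l1 t) + r2 t ^+ 2 * (l1 t - 2 * r2 t)))) k t u1) => //.
  - move=> x /andP[tx xu]; have xu' : 0 <= x <= u1 by rewrite xu (le_trans t0).
    by have c1 := cr1 _ xu'; have c2 := cr2 _ xu'; rewrite /B; cont.
  - move=> x /(itv_oo_subl t0) xu; have d := dA x xu.
    have d1 := traj_der_re_inv dr u1T u10 tr1 xu.
    have d2 := traj_der_re_inv dr u2T u20 tr2 (in2' _ xu).
    by apply: (der_mul d (der_add d1 (der_opp d2))).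
  - move=> x /andP[tx xu]; have xu' : 0 <= x <= u1 by rewrite xu (le_trans t0).
    have c1 := cr1 _ xu'; have c2 := cr2 _ xu'; have c3 := cv1 _ xu'; have c4 := cv2 _ xu'.
    have c5 : {for x, continuous l1}.
      by case: dr => _ h _ _ _; apply: h; exact: le_lt_trans xu u1T.
    have j0 : j x != 0 by rewrite gt_eqF // jp.
    have cj : {for x, continuous j} by rewrite /j; cont.
    have cq : {for x, continuous q} by rewrite /q; cont.
    by rewrite /k; cont.
  - move=> x /(itv_oo_subl t0) xu; have xu' := incc _ xu.
    have j0 := jp x xu'; have j0' : j x != 0 by rewrite gt_eqF.
    have alg : v1 x ^+ 2 * (6 * r1 x - l1 x) + r1 x ^+ 2 * (l1 x - 2 * r1 x) -
       (v2 x ^+ 2 * (6 * r2 x - l1 x) + r2 x ^+ 2 * (l1 x - 2 * r2 x)) -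
       k x * (r1 x - r2 x) =
       q x * (r2 x * (r1 x ^+ 2 + v1 x ^+ 2) - r1 x * (r2 x ^+ 2 + v2 x ^+ 2)) / j x
      := @tip_algebra R (l1 x) (r1 x) (v1 x) (r2 x) (v2 x) j0'.
    (* by the barrier r_j <= l1 / 6, so both brackets of q are nonpositive *)
    have q0 : q x <= 0.
      have [[[h1 h2] h3] h4] := (r1l x xu', r2l x xu', v1p x xu', v2p x xu').
      rewrite -oppr_ge0 /q opprD addr_ge0 // -mulrN mulr_ge0 ?(ltW h3) ?(ltW h4) //; lra.
    have p1 : 0 < r1 x ^+ 2 + v1 x ^+ 2 by apply: norm2_gt0; exact: v1p.
    have p2 : 0 < r2 x ^+ 2 + v2 x ^+ 2 by apply: norm2_gt0; exact: v2p.
    have e1 : X1 x * (r1 x ^+ 2 + v1 x ^+ 2) = r1 x.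
      have e : b1 x ^+ 2 = N1 x - X1 x ^+ 2 by rewrite /N1 /dist2 /X1; ring.
      rewrite /r1 /v1 !exprMn e; field; exact: n1'.
    have e2 : X2 x * (r2 x ^+ 2 + v2 x ^+ 2) = r2 x.
      have e : b2 x ^+ 2 = N2 x - X2 x ^+ 2 by rewrite /N2 /dist2 /X2; ring.
      rewrite /r2 /v2 !exprMn e; field; exact: n2'.
    have eA : A x = X2 x - X1 x by rewrite /A /X1 /X2 /offset; ring.
    have eM : r2 x * (r1 x ^+ 2 + v1 x ^+ 2) - r1 x * (r2 x ^+ 2 + v2 x ^+ 2) =
       A x * ((r1 x ^+ 2 + v1 x ^+ 2) * (r2 x ^+ 2 + v2 x ^+ 2)).
      by rewrite -{1}e2 -{2}e1 eA; ring.
    rewrite -subr_ge0.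
    have -> : k x * (A x * B x) - (- (2 * B x) * B x + A x *
      (v1 x ^+ 2 * (6 * r1 x - l1 x) + r1 x ^+ 2 * (l1 x - 2 * r1 x) -
       (v2 x ^+ 2 * (6 * r2 x - l1 x) + r2 x ^+ 2 * (l1 x - 2 * r2 x)))) =
      2 * B x ^+ 2 - A x * (v1 x ^+ 2 * (6 * r1 x - l1 x) + r1 x ^+ 2 * (l1 x - 2 * r1 x) -
       (v2 x ^+ 2 * (6 * r2 x - l1 x) + r2 x ^+ 2 * (l1 x - 2 * r2 x)) -
       k x * (r1 x - r2 x)) by rewrite /B; ring.
    rewrite [X in _ - A x * X]alg eM.
    have -> : A x * (q x * (A x * ((r1 x ^+ 2 + v1 x ^+ 2) * (r2 x ^+ 2 + v2 x ^+ 2))) / j x)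
      = q x * (A x ^+ 2 * ((r1 x ^+ 2 + v1 x ^+ 2) * (r2 x ^+ 2 + v2 x ^+ 2)) / j x) by ring.
    (* what remains is 2 B^2 + c A^2 with c = - q |z_1|^2 |z_2|^2 / j *)
    have P0 : 0 <= A x ^+ 2 * ((r1 x ^+ 2 + v1 x ^+ 2) * (r2 x ^+ 2 + v2 x ^+ 2)) / j x.
      by rewrite divr_ge0 ?(ltW j0) // mulr_ge0 ?sqr_ge0 // mulr_ge0 // ltW.
    have := mulr_le0_ge0 q0 P0; have := sqr_ge0 (B x); lra.
  - have uu : 0 <= u1 <= u1 by rewrite u10 lexx.
    apply: mulr_ge0; first by rewrite /A; lra.
    (* flow 1 ends on the barrier circle, where r_1 is as large as possible *)
    have e1 : r1 u1 = l1 u1 / 6.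
      have [_ _ _ e] := tr1; rewrite /r1 /X1 /N1 /dist2 /offset; have := n1 _ uu.
      rewrite /N1 /dist2 /offset => n0.
      have nz : (a1 u1 - l u1) ^+ 2 + b1 u1 ^+ 2 != 0 by rewrite gt_eqF.
      by apply: (mulIf nz); rewrite divfK //; lra.
    by rewrite /B e1 subr_ge0 r2l.
have Asq t : 0 <= t <= u1 -> A u1 ^+ 2 <= A t ^+ 2.
  move=> tu; have /andP[t0 tu1] := tu.
  apply: (@nonincr R (fun t => A t ^+ 2) (fun t => - (4 * (A t * B t)))) => //.
  - by move=> x _; cont.
  - by move=> x /(itv_oo_subl t0) xu; have d := dA x xu; deriv; ring.
  - by move=> x /(itv_oo_subl t0)/incc xu; rewrite oppr_le0 mulr_ge0 // AB.
have Au : 0 < A u1 by rewrite /A; lra.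
rewrite -subr_gt0 -/(A 0) ltNge; apply/negP => A0.
have [c cu Ac] : exists2 c, c \in `[0, u1]%R & A c = 0.
  apply: IVT => //; first exact: continuous_subspaceT.
  by rewrite ge_min A0 /= le_max (ltW Au) orbT.
have := Asq c; rewrite Ac expr0n /= => /(_ _) h.
have : A u1 ^+ 2 <= 0 by apply: h; move: cu; rewrite in_itv.
by rewrite leNgt exprn_gt0.
Qed.

(** * Flows that end in the singularity *)

(** The endpoint is Z = 1/(l1 u / 6 - iv), which tends to the singularity as
    v grows. *)
Lemma traj_exists (R : realType) (T : R) (l l1 l2 : R -> R) (u v : R) :
  driving T l l1 l2 -> 0 <= u -> u < T -> 0 < v ->
  exists a b, traj l l1 u a b /\
    (a u - l u) ^+ 2 + b u ^+ 2 <= (v ^+ 2)^-1.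
Proof.
move=> dr u0 uT v0; have [cl _ _ l10 _] := dr.
pose r := l1 u / 6; have r0 : 0 < r by rewrite divr_gt0 // l10 // u0.
pose n := r ^+ 2 + v ^+ 2; have n0 : 0 < n by exact: norm2_gt0.
have y0 : 0 < v / n by rewrite divr_gt0.
have [a [b [fl au bu bt]]] := flow_exists (l u + r / n) cl u0 y0.
have e : (a u - l u) ^+ 2 + b u ^+ 2 = n^-1.
  have -> : a u - l u = r / n by rewrite au; ring.
  by rewrite bu /n; field; rewrite gt_eqF.
exists a, b; split; last first.
  by rewrite e lef_pV2 ?posrE ?exprn_gt0 // /n lerDr sqr_ge0.
split => //.
- by move=> t tu; apply: lt_le_trans y0 (bt t tu).
- by rewrite au ltrDl divr_gt0.
- by rewrite e au /r; field; rewrite gt_eqF.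
Qed.

Lemma geo_near (R : realType) (C e : R) : 0 <= C -> 0 < e ->
  exists n0 : nat, forall n, (n0 <= n)%N -> C / 2 ^+ n <= e.
Proof.
move=> C0 e0; have [n0 h] := geo_small C e0; exists n0 => n n0n.
apply: le_trans h; rewrite ler_wpM2l // lef_pV2 ?posrE ?exprn_gt0 //.
by rewrite ler_weXn2l // ler1n.
Qed.

(** The point x + iy is swallowed exactly at time u, and it is a limit of
    points whose flow is regular up to time u. *)
Definition tip (R : realType) (l : R -> R) (u x y : R) :=
  (exists a b, [/\ flow l a b u, a 0 = x /\ b 0 = y, a u = l u, b u = 0 &
                   forall t, 0 <= t < u -> 0 < b t]) /\
  (forall e : R, 0 < e -> exists a b, [/\ flow l a b u,
     forall t, 0 <= t <= u -> 0 < b t, `|a 0 - x| <= e & `|b 0 - y| <= e]).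

(** The tip is the limit of regular flows ending on the barrier circle at
    1/(l1 u / 6 - i 2^n).  By [traj_close] these converge uniformly on [0, u];
    by [traj_b2_ge] their heights stay away from 0 on every [0, t'], t' < u,
    so the limit solves the equation there. *)
Lemma tip_exists (R : realType) (T : R) (l l1 l2 : R -> R) (u : R) :
  driving T l l1 l2 -> 0 < u -> u < T ->
  exists x y, tip l u x y /\
    forall e : R, 0 < e -> exists a b, [/\ traj l l1 u a b,
      `|a 0 - x| <= e, `|b 0 - y| <= e, a u - l u <= e & b u <= e].
Proof.
move=> dr u_gt0 uT; have u0 := ltW u_gt0; have [cl _ _ l10 _] := dr.
have uu : 0 <= u <= u by rewrite u0 lexx.
have /choice[A /choice[B ABP]] (n : nat) : exists a b, traj l l1 u a b /\
    (a u - l u) ^+ 2 + b u ^+ 2 <= ((2 ^+ n) ^+ 2)^-1.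
  by apply: (traj_exists dr) => //; rewrite exprn_gt0.
have tr n := (ABP n).1; have Nu n := (ABP n).2.
pose K := 2 * expR (l1 u ^+ 2 / 9 * u).
have K0 : 0 <= K by rewrite mulr_ge0 ?expR_ge0.
have p2 n : 0 < 2 ^+ n :> R by rewrite exprn_gt0.
have AuN n : A n u - l u <= 1 / 2 ^+ n /\ B n u <= 1 / 2 ^+ n.
  have h := Nu n; have [_ h1 h2 _] := tr n.
  have e2 : (1 / 2 ^+ n) ^+ 2 = ((2 ^+ n) ^+ 2)^-1 :> R by rewrite div1r exprVn.
  have d0 : 0 <= 1 / 2 ^+ n :> R by rewrite divr_ge0 // ltW.
  have bu := h1 u uu.
  split; rewrite -(ler_pXn2r (isT : (0 < 2)%N)) ?nnegrE ?e2 ?(ltW bu) //.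
  - by have := sqr_ge0 (B n u); lra.
  - lra.
  - by have := sqr_ge0 (A n u - l u); lra.
have step n t : 0 <= t <= u ->
    `|A n.+1 t - A n t| <= K / 2 ^+ n /\ `|B n.+1 t - B n t| <= K / 2 ^+ n.
  move=> tu; have /andP[t0 tu'] := tu.
  have h := traj_close dr uT u0 (tr n.+1) (tr n) tu.
  have h1 : (A n.+1 u - A n u) ^+ 2 + (B n.+1 u - B n u) ^+ 2 <= (2 / 2 ^+ n) ^+ 2.
    have hn := Nu n; have hn1 := Nu n.+1.
    have e2 : (2 / 2 ^+ n) ^+ 2 = 4 * ((2 ^+ n) ^+ 2)^-1 :> R.
      by rewrite expr_div_n; congr (_ * _); ring.
    have hh : ((2 ^+ n.+1) ^+ 2)^-1 <= ((2 ^+ n) ^+ 2)^-1 :> R.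
      rewrite lef_pV2 ?posrE ?exprn_gt0 // lerXn2r ?nnegrE ?(ltW (p2 _)) //.
      by rewrite exprS ler_peMl ?(ltW (p2 _)) // ler1n.
    rewrite e2.
    have -> : A n.+1 u - A n u = (A n.+1 u - l u) - (A n u - l u) by ring.
    have := sqr_ge0 ((A n.+1 u - l u) + (A n u - l u)).
    have := sqr_ge0 (B n.+1 u + B n u).
    move: hn hn1 hh; move: ((2 ^+ n.+1) ^+ 2)^-1 ((2 ^+ n) ^+ 2)^-1 => z1 z2.
    nra.
  have h2 : (A n.+1 t - A n t) ^+ 2 + (B n.+1 t - B n t) ^+ 2 <= (K / 2 ^+ n) ^+ 2.
    apply: le_trans h _; apply: (@le_trans _ _ ((2 / 2 ^+ n) ^+ 2 * expR (l1 u ^+ 2 / 9 * u) ^+ 2)).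
      apply: ler_pM => //; first by rewrite addr_ge0 ?sqr_ge0.
      rewrite -expRM_natl ler_expR.
      have : 0 <= l1 u ^+ 2 / 9 by rewrite divr_ge0 ?sqr_ge0.
      by move: (l1 u ^+ 2 / 9) => c c0; nra.
    by rewrite le_eqVlt; apply/orP; left; apply/eqP; rewrite /K !expr_div_n !exprMn; ring.
  have d0 : 0 <= K / 2 ^+ n by rewrite divr_ge0 // ltW.
  by split; rewrite -(ler_pXn2r (isT : (0 < 2)%N)) ?nnegrE // real_normK ?num_real //;
    apply: le_trans h2; rewrite ?lerDl ?lerDr sqr_ge0.
have /choice[a aP] t : exists z, forall n, `|A n (clamp 0 u t) - z| <= 2 * K / 2 ^+ n.
  by apply: geo_lim => // n; have [] := step n _ (clamp_in t u0).
have /choice[b bP] t : exists z, forall n, `|B n (clamp 0 u t) - z| <= 2 * K / 2 ^+ n.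
  by apply: geo_lim => // n; have [] := step n _ (clamp_in t u0).
have aP' t n : 0 <= t <= u -> `|A n t - a t| <= 2 * K / 2 ^+ n.
  by move=> tu; have := aP t n; rewrite clamp_id.
have bP' t n : 0 <= t <= u -> `|B n t - b t| <= 2 * K / 2 ^+ n.
  by move=> tu; have := bP t n; rewrite clamp_id.
have K20 : 0 <= 2 * K by rewrite mulr_ge0.
have ca : continuous a.
  apply: unif_limit_cont => e e0; have [n hn] := geo_small (2 * K) e0.
  exists (fun t => A n (clamp 0 u t)).
    by apply: cont_clamp => // x _; exact: (traj_cont_a (tr n)).
  by move=> x; apply: le_trans (aP _ _) hn.
have cb : continuous b.
  apply: unif_limit_cont => e e0; have [n hn] := geo_small (2 * K) e0.
  exists (fun t => B n (clamp 0 u t)).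
    by apply: cont_clamp => // x _; exact: (traj_cont_b (tr n)).
  by move=> x; apply: le_trans (bP _ _) hn.
have lim0 (z : R) : (forall n, `|z| <= (2 * K + 1) / 2 ^+ n) -> z = 0.
  move=> h; apply/eqP; rewrite -normr_eq0 eq_le normr_ge0 andbT.
  apply/ler_addgt0Pl => e e0; rewrite addr0.
  by have [n hn] := geo_small (2 * K + 1) e0; apply: le_trans (h n) hn.
have au : a u = l u.
  apply/eqP; rewrite -subr_eq0; apply/eqP/lim0 => n.
  have h1 := aP' u n uu; have [h2 _] := AuN n; have [_ _ h3 _] := tr n.
  rewrite mulrDl; move: h1; rewrite !ler_norml => /andP[? ?]; apply/andP; split; lra.
have bu : b u = 0.
  apply: lim0 => n.
  have h1 := bP' u n uu; have [_ h2] := AuN n; have [_ h3 _ _] := tr n.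
  have h4 := h3 u uu.
  rewrite mulrDl; move: h1; rewrite !ler_norml => /andP[? ?]; apply/andP; split; lra.
have l1u : 0 < l1 u by rewrite l10 // u0.
have low t' : 0 <= t' -> t' < u -> exists (m : R) (n0 : nat), [/\ 0 < m,
    forall n t, (n0 <= n)%N -> 0 <= t <= t' -> m <= B n t &
    forall t, 0 <= t <= t' -> m <= b t].
  move=> t'0 t'u.
  have i0 : 0 < (l1 u)^-1 by rewrite invr_gt0.
  have [d d0 hd] : exists2 d, 0 < d & forall s, u - d <= s <= u -> l u - l s <= (l1 u)^-1.
    have /cvgrPdist_le /(_ _ i0) := cl u.
    move=> /nbhs_ballP[d /= d0 hd]; exists (d / 2); first by rewrite divr_gt0.
    move=> s /andP[s1 s2]; apply: le_trans (ler_norm _) _; apply: hd.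
    by rewrite /ball /= ger0_norm; lra.
  pose t1 := Num.max t' (u - d).
  have t1u : t1 < u by rewrite /t1 gt_max t'u; lra.
  have t't1 : t' <= t1 by rewrite /t1 le_max lexx.
  have t10 : 0 <= t1 := le_trans t'0 t't1.
  have t1d : u - d <= t1 by rewrite /t1 le_max lexx orbT.
  (* m^2 <= m <= 2 (u - t1) avoids a square root *)
  pose m := Num.min 1 (2 * (u - t1)).
  have m0 : 0 < m by rewrite /m lt_min ltr01 mulr_gt0 // subr_gt0.
  have m2 : m ^+ 2 <= 2 * (u - t1).
    apply: (@le_trans _ _ m); last by rewrite /m ge_min lexx orbT.
    by rewrite expr2 ler_piMr ?(ltW m0) // /m ge_min lexx.
  have [n1 hn1] := geo_near ler01 i0.
  have low1 n t : (n1 <= n)%N -> 0 <= t <= t' -> m <= B n t.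
    move=> n1n /andP[t0 tt'].
    have t1in : 0 <= t1 <= u by rewrite t10 ltW.
    have B0 : 0 < B n t1 by apply: (traj_b_gt0 (tr n)).
    have h1 : m <= B n t1.
      rewrite -(ler_pXn2r (isT : (0 < 2)%N)) ?nnegrE ?(ltW m0) ?(ltW B0) //.
      apply: le_trans m2 _; apply: (traj_b2_ge dr uT u0 (tr n)) => // s /andP[ts su].
      have s0 : 0 <= s := le_trans t10 ts.
      have sI : 0 <= s <= u by rewrite s0.
      have h2 : A n s <= A n u by apply: (traj_a_mono dr uT u0 (tr n)).
      have [h3 _] := AuN n; have h4 := hn1 n n1n.
      have h5 : l u - l s <= (l1 u)^-1 by apply: hd; rewrite su (le_trans t1d).
      have h6 : l1 s <= l1 u by apply: (driving_l1_mono dr).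
      have h7 := traj_offset_gt0 dr uT u0 (tr n) sI.
      have h8 : offset l (A n) s <= 3 * (l1 u)^-1 by rewrite /offset; lra.
      have h9 : 0 <= l1 s by apply/ltW/l10; rewrite s0 (le_lt_trans su).
      have := ler_pM h9 (ltW h7) h6 h8.
      by rewrite mulrCA divff ?mulr1 // gt_eqF.
    by apply: le_trans h1 _; apply: (traj_b_mono (tr n)) => //;
      [exact: le_trans t't1|exact: ltW].
  have m20 : 0 < m / 2 by rewrite divr_gt0.
  have [n2 hn2] := geo_near K20 m20.
  exists (m / 2), n1; split => //.
    by move=> n t n1n tt'; have := low1 n t n1n tt'; lra.
  move=> t tt'; have h1 := low1 (n1 + n2)%N t (leq_addr _ _) tt'.
  have tu : 0 <= t <= u by case/andP: tt' => -> tt'; rewrite (le_trans tt') // ltW.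
  have := bP' t (n1 + n2)%N tu; have := hn2 (n1 + n2)%N (leq_addl _ _).
  by rewrite ler_norml => ? /andP[? ?]; lra.
have flab : flow l a b u.
  split => // t /andP[t0 tu].
  pose t' := (t + u) / 2.
  have t't : t < t' by rewrite /t'; lra.
  have t'u : t' < u by rewrite /t'; lra.
  have t'0 : 0 <= t' by rewrite /t'; lra.
  have [m [n0 [m0 mB mb]]] := low t' t'0 t'u.
  have nz x : 0 <= x <= t' -> (a x - l x) ^+ 2 + b x ^+ 2 != 0.
    by move=> xt; rewrite gt_eqF // norm2_gt0 // (lt_le_trans m0) // mb.
  have tt' : 0 < t < t' by rewrite t0.
  have in1 x : 0 <= x <= t' -> 0 <= x <= u.
    by move=> /andP[-> xt]; rewrite (le_trans xt) // ltW.
  have in2 x : 0 < x < t' -> 0 < x < u.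
    by move=> /andP[-> xt]; rewrite (lt_trans xt).
  have in3 x : 0 < x < t' -> 0 <= x <= t' by move=> /andP[*]; rewrite !ltW.
  have m20 : 0 < m ^+ 2 by rewrite exprn_gt0.
  have app e : 0 < e -> exists n, [/\ 2 * K / 2 ^+ n <= e,
      2 * ((2 * K / 2 ^+ n + 2 * K / 2 ^+ n) / m ^+ 2) <= e & (n0 <= n)%N].
    move=> e0.
    have e'0 : 0 < e * m ^+ 2 / 4 by rewrite divr_gt0 // mulr_gt0.
    have [n1 h1] := geo_near K20 e0; have [n2 h2] := geo_near K20 e'0.
    exists (n0 + (n1 + n2))%N; split; last exact: leq_addr.
      by apply: h1; rewrite addnCA leq_addr.
    have h := h2 (n0 + (n1 + n2))%N; have {}h := h _.
    rewrite mulrA ler_pdivrMr //.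
    have : 2 * K / 2 ^+ (n0 + (n1 + n2)) <= e * m ^+ 2 / 4.
      by apply: h2; rewrite addnA leq_addl.
    lra.
  have N2 (P Q D : R) : `|P - Q| <= D -> `|2 * P - 2 * Q| <= 2 * D.
    by rewrite -mulrBr normrM ger0_norm // ler_pM2l.
  split.
    apply: (@derive_unif_limit R a
      (fun t => 2 * ((a t - l t) * ((a t - l t) ^+ 2 + b t ^+ 2)^-1)) 0 t') => //.
      by move=> x xt; have h := nz x xt; cont.
    move=> e e0; have [n [h1 h2 n0n]] := app e e0.
    exists (A n), (fun t => 2 * (offset l (A n) t / dist2 l (A n) (B n) t)); split.
    - by move=> x _; exact: (traj_cont_a (tr n)).
    - by move=> x /in2 xu; exact: (traj_der_a (tr n)).
    - by move=> x /in1 xu; apply: le_trans (aP' x n xu) h1.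
    - move=> x /in3 xt; apply: le_trans h2; apply: N2.
      have [h _] := inv_lip (A n x - l x) (a x - l x) m0 (mB n x n0n xt) (mb x xt).
      apply: le_trans h _; rewrite ler_wpM2r ?invr_ge0 ?(ltW m20) //.
      have -> : A n x - l x - (a x - l x) = A n x - a x by ring.
      by rewrite lerD ?aP' ?bP' ?in1.
  apply: (@derive_unif_limit R b
    (fun t => - (2 * (b t * ((a t - l t) ^+ 2 + b t ^+ 2)^-1))) 0 t') => //.
    by move=> x xt; have h := nz x xt; cont.
  move=> e e0; have [n [h1 h2 n0n]] := app e e0.
  exists (B n), (fun t => - (2 * (B n t / dist2 l (A n) (B n) t))); split.
  - by move=> x _; exact: (traj_cont_b (tr n)).
  - by move=> x /in2 xu; exact: (traj_der_b (tr n)).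
  - by move=> x /in1 xu; apply: le_trans (bP' x n xu) h1.
  - move=> x /in3 xt; apply: le_trans h2; rewrite -opprD normrN; apply: N2.
    have [_ h] := inv_lip (A n x - l x) (a x - l x) m0 (mB n x n0n xt) (mb x xt).
    apply: le_trans h _; rewrite ler_wpM2r ?invr_ge0 ?(ltW m20) //.
    have -> : A n x - l x - (a x - l x) = A n x - a x by ring.
    by rewrite lerD ?aP' ?bP' ?in1.
have o0 : (0 : R) <= 0 <= u by rewrite lexx.
have appr e : 0 < e -> exists a' b', [/\ traj l l1 u a' b',
      `|a' 0 - a 0| <= e, `|b' 0 - b 0| <= e, a' u - l u <= e & b' u <= e].
  move=> e0; have [n1 h1] := geo_near K20 e0; have [n2 h2] := geo_near ler01 e0.
  exists (A (n1 + n2)%N), (B (n1 + n2)%N); have [h3 h4] := AuN (n1 + n2)%N.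
  have h5 := h1 (n1 + n2)%N (leq_addr _ _); have h6 := h2 (n1 + n2)%N (leq_addl _ _).
  split; first exact: tr.
  - exact: le_trans (aP' _ _ o0) h5.
  - exact: le_trans (bP' _ _ o0) h5.
  - exact: le_trans h3 h6.
  - exact: le_trans h4 h6.
exists (a 0), (b 0); split => //; split.
  exists a, b; split => // t /andP[t0 tu].
  have [m [n0 [m0 _ mb]]] := low t t0 tu.
  by apply: lt_le_trans m0 (mb t _); rewrite t0 lexx.
move=> e /appr[a' [b' [[fl' b'0 _ _] h1 h2 _ _]]].
by exists a', b'.
Qed.

(** * Convergence of the tips *)

(** Re z_u is monotone by [traj_order] and bounded by l T; Im z_u tends to 0
    by [traj_height]. *)
Lemma tips_converge (R : realType) (T : R) (l l1 l2 : R -> R) : 0 < T ->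
  driving T l l1 l2 ->
  (forall t, 0 <= t < T -> 16 * (T - t) <= (l T - l t) ^+ 2) ->
  exists p : R, forall e : R, 0 < e -> exists2 t0, 0 <= t0 < T &
    forall u, t0 < u < T -> exists x y, [/\ tip l u x y, `|x - p| <= e & `|y| <= e].
Proof.
move=> T0 dr HG; have [cl _ _ _ _] := dr.
have G0 t : 0 <= t < T -> 0 < l T - l t.
  move=> tT; have h := HG t tT; case/andP: tT => t0 tT.
  have h1 : 0 <= l T - l t by rewrite subr_ge0; apply: (driving_l_mono dr) => //; exact: ltW.
  rewrite lt_neqAle h1 andbT; apply/eqP => e; rewrite -e expr0n /= in h; lra.
have /choice[x /choice[y xyP]] (u : R) : exists x y, 0 < u < T -> tip l u x y /\
    forall e : R, 0 < e -> exists a b, [/\ traj l l1 u a b,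
      `|a 0 - x| <= e, `|b 0 - y| <= e, a u - l u <= e & b u <= e].
  have [uT|uT] := boolP (0 < u < T); last by exists 0, 0.
  by case/andP: (uT) => u0 uT'; have [x [y h]] := tip_exists dr u0 uT'; exists x, y.
have mono u1 u2 : 0 < u1 -> u1 <= u2 -> u2 < T -> x u1 <= x u2.
  move=> u10 u12 u2T.
  have u1T := le_lt_trans u12 u2T; have u20 := lt_le_trans u10 u12.
  apply/ler_addgt0Pl => e e0.
  have [_ H1] := xyP u1 (introT andP (conj u10 u1T)).
  have [_ H2] := xyP u2 (introT andP (conj u20 u2T)).
  have e2 : 0 < e / 2 by rewrite divr_gt0.
  have [a2 [b2 [tr2 h2 _ _ _]]] := H2 _ e2.
  have u1I : 0 <= u1 <= u2 by rewrite ltW.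
  have X2 := traj_offset_gt0 dr u2T (ltW u20) tr2 u1I; rewrite /offset in X2.
  have e'0 : 0 < Num.min (e / 2) ((a2 u1 - l u1) / 2) by rewrite lt_min e2 divr_gt0.
  have [a1 [b1 [tr1 h1 _ h1u _]]] := H1 _ e'0.
  move: h1 h1u; rewrite !le_min => /andP[h1 _] /andP[_ h1u].
  have au : a1 u1 < a2 u1 by lra.
  have := traj_order dr (ltW u10) u12 u2T tr1 tr2 au.
  by move: h1 h2; rewrite !ler_norml => /andP[? ?] /andP[? ?]; lra.
have bnd u : 0 < u -> u < T -> x u <= l T.
  move=> u0 uT; apply/ler_addgt0Pl => e e0.
  have [_ H1] := xyP u (introT andP (conj u0 uT)).
  have e2 : 0 < e / 2 by rewrite divr_gt0.
  have [a [b [tr h _ hu _]]] := H1 _ e2.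
  have : a 0 <= a u by apply: (traj_a_mono dr uT (ltW u0) tr); rewrite lexx ltW.
  have : l u <= l T by apply: (driving_l_mono dr) => //; exact: ltW.
  by move: h; rewrite !ler_norml => /andP[? ?]; lra.
pose S := [set x u | u in [set u | 0 < u < T]].
pose p := sup S.
have hs : has_sup S.
  split; first by exists (x (T / 2)), (T / 2) => //=; apply/andP; split; lra.
  by exists (l T) => _ [u /= /andP[u0 uT] <-]; exact: bnd.
exists p => e e0.
have [u1 u1T pu1] : exists2 u1, 0 < u1 < T & p - e < x u1.
  by have [_ [u1 /= u1T <-] h] := sup_adherent e0 hs; exists u1.
have [u10 u1T'] := andP u1T.
(* once ln (l T - l u) <= L, the bound of [traj_height] forces b 0 <= e / 2 *)
pose L := ln (l T - l 0) - 3 * (l T - l 0 + 1) / e.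
have [t1 t1T ht1] : exists2 t1, t1 < T & forall u, t1 < u < T -> l T - l u <= expR L.
  have /cvgrPdist_le /(_ _ (expR_gt0 L)) := cl T.
  move=> /nbhs_ballP[d /= d0 hd]; exists (T - d); first lra.
  move=> u /andP[u1' u2']; apply: le_trans (ler_norm _) _; apply: hd.
  by rewrite /ball /= ger0_norm; lra.
exists (Num.max u1 t1); first by rewrite le_max (ltW u10) gt_max u1T' t1T.
move=> u /andP[]; rewrite gt_max => /andP[u1u t1u] uT.
have u0 : 0 < u := lt_trans u10 u1u.
have [tipu H] := xyP u (introT andP (conj u0 uT)).
exists (x u), (y u); split => //.
  have h1 : x u <= p by apply: ub_le_sup; [case: hs|exists u => //=; rewrite u0].
  have h2 : x u1 <= x u by apply: mono => //; exact: ltW.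
  by rewrite ler_norml; apply/andP; split; lra.
(* e1 <= 1 and e1 <= 4 (T - u) give (b u)^2 <= 4 (T - u) *)
pose e1 := Num.min (Num.min (e / 2) 1) (4 * (T - u)).
have e10 : 0 < e1.
  by rewrite !lt_min ltr01 divr_gt0 //= mulr_gt0 // subr_gt0.
have e1e : e1 <= e / 2 by rewrite /e1 !ge_min lexx.
have e11 : e1 <= 1 by rewrite /e1 !ge_min lexx orbT.
have e1T : e1 <= 4 * (T - u) by rewrite /e1 ge_min lexx orbT.
have [a [b [tr ha hb hau hbu]]] := H _ e10.
have uu : 0 <= u <= u by rewrite lexx ltW.
have o0 : (0 : R) <= 0 <= u by rewrite lexx ltW.
have bu0 := traj_b_gt0 tr uu; have b00 := traj_b_gt0 tr o0.
have bu2 : b u ^+ 2 <= 4 * (T - u).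
  apply: (@le_trans _ _ e1) => //; apply: (@le_trans _ _ (1 * e1)); last by rewrite mul1r.
  by rewrite expr2; apply: ler_pM => //; rewrite ?(ltW bu0) //; lra.
have hG t : 0 <= t <= u -> 0 < l T - l t /\ 16 * (T - t) <= (l T - l t) ^+ 2.
  move=> /andP[t0 tu]; have tT : 0 <= t < T by rewrite t0 (le_lt_trans tu).
  by split; [exact: G0|exact: HG].
have h := traj_height dr uT (ltW u0) tr hG bu2.
have Gu : 0 < l T - l u by apply: G0; rewrite uT ltW.
have GO : 0 < l T - l 0 by apply: G0; rewrite T0 lexx.
have lnu : ln (l T - l u) <= L.
  rewrite -(expRK L) ler_ln ?posrE ?expR_gt0 //; apply: ht1.
  by rewrite t1u.
have hX : offset l a 0 <= l T - l 0 + 1.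
  have := bnd u u0 uT; have : a 0 <= x u + 1.
    by move: ha; rewrite ler_norml => /andP[? ?]; lra.
  by rewrite /offset; lra.
have hb2 : b 0 <= e / 2.
  have h3 : 2 / e * (l T - l 0 + 1) <= offset l a 0 / b 0.
    apply: le_trans h.
    have -> : 2 / e * (l T - l 0 + 1) = 2 / 3 * (3 * (l T - l 0 + 1) / e).
      by field; rewrite gt_eqF.
    by rewrite ler_pM2l ?divr_gt0 //; move: lnu; rewrite /L; lra.
  rewrite ler_pdivlMr // in h3.
  have h4 : 2 / e * (l T - l 0 + 1) * b 0 <= l T - l 0 + 1 by apply: le_trans h3 hX.
  have h5 : 0 < l T - l 0 + 1 by lra.
  rewrite mulrAC ger_pMl // in h4.
  rewrite ler_pdivlMr // mulrC -(ler_pM2l (_ : 0 < e^-1)) ?invr_gt0 //.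
  by rewrite mulVf ?gt_eqF // mulrA [e^-1 * 2]mulrC.
move: hb; rewrite !ler_norml => /andP[? ?]; apply/andP; split; lra.
Qed.

(** Reflection in the imaginary axis. *)
Lemma flow_opp (R : realType) (l a b : R -> R) (u : R) :
  flow (fun t => - l t) a b u -> flow l (fun t => - a t) b u.
Proof.
move=> [ca cb dab]; split => //; first by apply: cont_all => t; cont.
move=> t tu; have [d1 d2] := dab t tu.
have e : (- a t - l t) ^+ 2 = (a t - - l t) ^+ 2 by ring.
rewrite e; split => //; have d := der_opp d1; apply: (der_eq d).
by rewrite -mulrN -mulNr; congr (_ * (_ / _)); ring.
Qed.

Lemma tip_opp (R : realType) (l : R -> R) (u x y : R) :
  tip (fun t => - l t) u x y -> tip l u (- x) y.
Proof.
move=> [[a [b [fl [a0 b0] au bu bp]]] H]; split.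
  exists (fun t => - a t), b; split => //; first exact: flow_opp.
  - by rewrite a0.
  - by rewrite au opprK.
move=> e e0; have [a' [b' [fl' bp' h1 h2]]] := H e e0.
exists (fun t => - a' t), b'; split => //; first exact: flow_opp.
by rewrite -opprD normrN.
Qed.

(** * Complex limits and difference quotients *)

Lemma complex_normE (R : realType) (z : R[i]) :
  `|z| = (Num.sqrt (complex.Re z ^+ 2 + complex.Im z ^+ 2))%:C.
Proof. by rewrite normc_def. Qed.

(** The radii in R[i] are complex numbers; this restates convergence with
    real ones. *)
Lemma complex_cvgP (R : realType) (T : Type) (F : set_system T) (FF : Filter F)
    (f : T -> R[i]) (z : R[i]) :
  f @ F --> z <-> forall e : R, 0 < e -> \forall t \near F,
    `|complex.Re (f t) - complex.Re z| <= e /\ `|complex.Im (f t) - complex.Im z| <= e.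
Proof.
have ReB (u v : R[i]) : complex.Re (u - v) = complex.Re u - complex.Re v by case: u; case: v.
have ImB (u v : R[i]) : complex.Im (u - v) = complex.Im u - complex.Im v by case: u; case: v.
split=> [/cvgrPdist_le H e e0|H].
  have eC : 0 < e%:C by rewrite ltcR.
  have := H _ eC; apply: filterS => t; rewrite complex_normE lecR ReB ImB => h.
  rewrite (distrC (complex.Re _)) (distrC (complex.Im _)).
  by split; apply: le_trans h; rewrite -sqrtr_sqr ler_wsqrtr // ?lerDl ?lerDr sqr_ge0.
apply/cvgrPdist_le => e; rewrite ltcE /= => /andP[/eqP e1 e2].
have e0 : 0 < complex.Re e / 2 by rewrite divr_gt0.
have := H _ e0; apply: filterS => t [h1 h2].
rewrite complex_normE lecE /= e1 eqxx /= ReB ImB.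
rewrite -(ler_pXn2r (isT : (0 < 2)%N)) ?nnegrE ?sqrtr_ge0 ?(ltW e2) //.
rewrite sqr_sqrtr ?addr_ge0 ?sqr_ge0 //.
rewrite distrC in h1; rewrite distrC in h2.
have h3 (x : R) : `|x| <= complex.Re e / 2 -> x ^+ 2 <= (complex.Re e / 2) ^+ 2.
  by move=> h; rewrite -(real_normK (num_real x)) lerXn2r ?nnegrE ?(ltW e0).
by have := h3 _ h1; have := h3 _ h2; have := sqr_ge0 (complex.Re e); lra.
Qed.

Lemma within_punctured (R : realType) (A : set R) (x d : R) (P : R -> Prop) : 0 < d ->
  (forall y, `|y - x| < d -> y != x -> A y -> P y) ->
  \forall y \near within A x^', P y.
Proof.
move=> d0 H.
have K : \forall y \near x, y != x -> A y -> P y.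
  by apply/nbhs_ballP; exists d => //= y; rewrite /ball /= distrC => yx; exact: H.
exact: K.
Qed.

Lemma within_puncturedE (R : realType) (A : set R) (x : R) (P : R -> Prop) :
  (\forall y \near within A x^', P y) ->
  exists2 d, 0 < d & forall y, `|y - x| < d -> y != x -> A y -> P y.
Proof.
move=> H.
have /nbhs_ballP[d /= d0 hd] : \forall y \near x, y != x -> A y -> P y by exact: H.
by exists d => // y yx; apply: hd; rewrite /ball /= distrC.
Qed.

(** At an interior point of A a difference quotient restricted to A has the
    usual derivative as its limit. *)
Lemma der_of_quot (R : realType) (f : R -> R) (x d r : R) (A : set R) : 0 < r ->
  (forall y, `|y - x| < r -> A y) ->
  (forall e, 0 < e -> \forall y \near within A x^', `|(f y - f x) / (y - x) - d| <= e) ->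
  is_derive x 1 f d.
Proof.
move=> r0 xA H; apply/is_derive1_caratheodory.
exists (fun z => if z == x then d else (f z - f x) / (z - x)); split; last by rewrite eqxx.
- move=> z; case: eqP => [->|/eqP zx]; first by rewrite !subrr mulr0.
  by rewrite divfK // subr_eq0.
- apply/cvgrPdist_le => e e0; rewrite eqxx.
  have [s s0 hs] := within_puncturedE (H e e0).
  apply/nbhs_ballP; exists (Num.min r s); first by rewrite /= lt_min r0.
  move=> y; rewrite /ball /= distrC lt_min => /andP[yr ys].
  case: eqP => [_|/eqP yx]; first by rewrite subrr normr0 ltW.
  by rewrite distrC; apply: hs => //; exact: xA.
Qed.

(** At w = 0 the restricted quotient is one-sided; the mean value theorem
    covers this case together with the interior points. *)
Lemma quot_of_der (R : realType) (f F : R -> R) (s w : R) : 0 <= w < s ->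
  (forall t, 0 <= t < s -> {for t, continuous f}) ->
  (forall t, 0 < t < s -> is_derive t 1 f (F t)) ->
  {for w, continuous F} -> forall e, 0 < e ->
  \forall v \near within `[0, s[ w^', `|(f v - f w) / (v - w) - F w| <= e.
Proof.
move=> /andP[w0 ws] cf df /cvgrPdist_le cF e e0.
have /nbhs_ballP[d /= d0 hd] := cF e e0.
apply: (within_punctured d0) => v vw; rewrite /= in_itv /= => vnw /andP[v0 vs].
have [c cw cE] : exists2 c, `|c - w| < d & f v - f w = F c * (v - w).
  move: vnw; rewrite neq_lt => /orP[h|h].
    have [||c _ /(_ h)[/andP[c1 c2] cE]] := @mean_value R f F v w (ltW h).
    - by move=> x /andP[x1 x2]; apply: cf; rewrite (le_trans v0) // (le_lt_trans x2).
    - by move=> x /andP[x1 x2]; apply: df; rewrite (le_lt_trans v0) // (lt_trans x2).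
    exists c; last by rewrite -opprB cE -mulrN opprB.
    by apply: le_lt_trans vw; rewrite !ler0_norm; lra.
  have [||c _ /(_ h)[/andP[c1 c2] cE]] := @mean_value R f F w v (ltW h).
  - by move=> x /andP[x1 x2]; apply: cf; rewrite (le_trans w0) // (le_lt_trans x2).
  - by move=> x /andP[x1 x2]; apply: df; rewrite (le_lt_trans w0) // (lt_trans x2).
  exists c => //.
  by apply: le_lt_trans vw; rewrite !ger0_norm; lra.
rewrite cE mulfK ?subr_eq0 // distrC; apply: hd.
by rewrite /ball /= distrC.
Qed.

Lemma cont_of_quot (R : realType) (f : R -> R) (x d : R) (A : set R) :
  (forall e, 0 < e -> \forall y \near within A x^', `|(f y - f x) / (y - x) - d| <= e) ->
  forall e, 0 < e -> exists2 r, 0 < r &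
    forall y, `|y - x| < r -> A y -> `|f y - f x| <= e.
Proof.
move=> H e e0; have [r r0 hr] := within_puncturedE (H 1 ltr01).
have D0 : 0 < `|d| + 1 by rewrite ltr_wpDl.
exists (Num.min r (e / (`|d| + 1))); first by rewrite lt_min r0 divr_gt0.
move=> y; rewrite lt_min => /andP[yr ye] Ay.
have [->|yx] := eqVneq y x; first by rewrite subrr normr0 ltW.
have h := hr y yr yx Ay.
have -> : f y - f x = (f y - f x) / (y - x) * (y - x) by rewrite divfK // subr_eq0.
rewrite normrM.
have h1 : `|(f y - f x) / (y - x)| <= `|d| + 1.
  rewrite -[_ / _](subrK d) addrC; apply: le_trans (ler_normD _ _) _.
  by rewrite lerD2l.
apply: (@le_trans _ _ ((`|d| + 1) * (e / (`|d| + 1)))).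
  by apply: ler_pM => //; exact: ltW.
by rewrite mulrC divfK // gt_eqF.
Qed.

Lemma within_clamp (R : realType) (T : topologicalType) (f : R -> T) (a b : R) : a <= b ->
  {within `[a, b], continuous f} -> continuous (f \o clamp a b).
Proof.
move=> ab /subspace_continuousP cf x.
have cx : a <= clamp a b x <= b by exact: clamp_in.
have H : clamp a b @ x --> within `[a, b] (nbhs (clamp a b x)).
  move=> P /=; rewrite nbhs_filterE => /(@clamp_cont R a b x) h.
  have {}h : \forall t \near x, `[a, b]%classic (clamp a b t) -> P (clamp a b t) by exact: h.
  suff : \forall t \near x, P (clamp a b t) by [].
  by apply: filterS h => y; apply; rewrite /= in_itv /=; exact: clamp_in.
have H2 : f @ within `[a, b] (nbhs (clamp a b x)) --> f (clamp a b x).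
  by apply: cf; rewrite /= in_itv.
exact: (cvg_comp _ _ H H2).
Qed.

Lemma Re_div_real (R : realType) (z w : R[i]) (r : R) :
  complex.Re ((z - w) / r%:C) = (complex.Re z - complex.Re w) / r /\
  complex.Im ((z - w) / r%:C) = (complex.Im z - complex.Im w) / r.
Proof.
have -> : (r%:C)^-1 = (r^-1)%:C by rewrite fmorphV.
by case: z => a b; case: w => a' b' /=; split; ring.
Qed.

Lemma loewner_field (R : realType) (z : R[i]) (c : R) :
  let X := complex.Re z - c in let Y := complex.Im z in
  complex.Re (2 / (z - c%:C)) = 2 * (X / (X ^+ 2 + Y ^+ 2)) /\
  complex.Im (2 / (z - c%:C)) = - (2 * (Y / (X ^+ 2 + Y ^+ 2))).
Proof.
case: z => a b /=; rewrite oppr0 addr0 mulrN; split; ring.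
Qed.

(** * Flows and hulls *)

Lemma flow_restrict (R : realType) (l a b : R -> R) (s u : R) : s <= u ->
  flow l a b u -> flow l a b s.
Proof.
move=> su [ca cb dab]; split => // t /andP[t0 ts]; apply: dab.
by rewrite t0 (lt_le_trans ts).
Qed.

Lemma hull_mem (R : realType) (lambda l a b : R -> R) (u t : R) :
  0 < u -> u <= t -> continuous l ->
  (forall s, 0 <= s <= u -> lambda s = l s) ->
  flow l a b u -> (forall s, 0 <= s < u -> 0 < b s) -> a u = l u -> b u = 0 ->
  loewner_hull lambda t (a 0 +i* b 0).
Proof.
move=> u0 ut cl ll [ca cb dab] bp au bu; split.
  by rewrite /closed_upper_half_plane /= ltW // bp // lexx.
exists u; split; first by rewrite in_itv /= (ltW u0).
exists (fun s => a s +i* b s); split; last by rewrite au bu ll // lexx ltW.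
- split => // w; rewrite in_itv /= => wu.
  have wu' : 0 <= w <= u by case/andP: wu => -> /ltW.
  split; first by rewrite eq_complex /= negb_and (gt_eqF (bp w wu)) orbT.
  apply/complex_cvgP => e e0.
  have [f1 f2] := loewner_field (a w +i* b w) (lambda w).
  rewrite f1 f2 ll //.
  have N0 : (a w - l w) ^+ 2 + b w ^+ 2 != 0 by rewrite gt_eqF // norm2_gt0 // bp.
  have q1 := @quot_of_der R a (fun t => 2 * ((a t - l t) * ((a t - l t) ^+ 2 + b t ^+ 2)^-1))
     u w wu (fun t _ => ca t) (fun t tu => (dab t tu).1) _ e e0.
  have q2 := @quot_of_der R b (fun t => - (2 * (b t * ((a t - l t) ^+ 2 + b t ^+ 2)^-1)))
     u w wu (fun t _ => cb t) (fun t tu => (dab t tu).2) _ e e0.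
  have c1 : {for w, continuous (fun t => 2 * ((a t - l t) * ((a t - l t) ^+ 2 + b t ^+ 2)^-1))}
    by cont.
  have c2 : {for w, continuous (fun t => - (2 * (b t * ((a t - l t) ^+ 2 + b t ^+ 2)^-1)))}
    by cont.
  apply: filterS2 (q1 c1) (q2 c2) => v h1 h2.
  have [-> ->] := Re_div_real (a v +i* b v) (a w +i* b w) (v - w).
  by split.
- apply: continuous_subspaceT => x; apply/complex_cvgP => e e0 /=.
  have /cvgrPdist_le /(_ _ e0) h1 := ca x; have /cvgrPdist_le /(_ _ e0) h2 := cb x.
  by apply: filterS2 h1 h2 => y k1 k2; split; rewrite distrC.
Qed.

Lemma le0_left_limit (R : realType) (f : R -> R) (s : R) : 0 < s ->
  {for s, continuous f} -> (forall t, 0 <= t < s -> f t <= 0) -> f s <= 0.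
Proof.
move=> s0 /cvgrPdist_le cf H; apply/ler_addgt0Pl => e e0; rewrite addr0.
have /nbhs_ballP[d /= d0 hd] := cf e e0.
have h : `|f s - f (Num.max 0 (s - d / 2))| <= e.
  apply: hd; rewrite /ball /= ger0_norm; last by rewrite subr_ge0 ge_max ltW //; lra.
  by have : s - d / 2 <= Num.max 0 (s - d / 2); [rewrite le_max lexx orbT|lra].
have h2 : f (Num.max 0 (s - d / 2)) <= 0.
  by apply: H; rewrite le_max lexx gt_max s0; lra.
by move: h; rewrite ler_norml => /andP[]; lra.
Qed.

(** A flow that reaches the singularity would have to coincide with the
    regular one: the squared distance E between the two satisfies a linear
    equation E' = k E with E(0) = 0. *)
Lemma hull_notin (R : realType) (lambda l a b : R -> R) (u : R) :
  0 <= u -> continuous l ->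
  (forall s, 0 <= s <= u -> lambda s = l s) ->
  flow l a b u -> (forall s, 0 <= s <= u -> 0 < b s) ->
  ~ loewner_hull lambda u (a 0 +i* b 0).
Proof.
move=> u0 cl ll [ca cb dab] bp [_ [s [+ [g [[g0 gfl] cg gs]]]]].
rewrite in_itv /= => /andP[s0 su].
have bs : 0 < b s by apply: bp; rewrite s0.
have cG := within_clamp s0 cg.
pose p t := complex.Re (g (clamp 0 s t)); pose q t := complex.Im (g (clamp 0 s t)).
have cp : continuous p.
  move=> x; apply/cvgrPdist_le => e e0.
  have /complex_cvgP /(_ _ e0) := cG x.
  by apply: filterS => y [h _]; rewrite distrC.
have cq : continuous q.
  move=> x; apply/cvgrPdist_le => e e0.
  have /complex_cvgP /(_ _ e0) := cG x.
  by apply: filterS => y [_ h]; rewrite distrC.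
have ss : 0 <= s <= s by rewrite s0 lexx.
have o0 : (0 : R) <= 0 <= s by rewrite lexx s0.
have p0 : p 0 = a 0 by rewrite /p clamp_id // g0.
have q0 : q 0 = b 0 by rewrite /q clamp_id // g0.
have qs : q s = 0 by rewrite /q clamp_id // gs.
have [s_0|s_gt0] : s = 0 \/ 0 < s.
  by move: s0; rewrite le_eqVlt => /orP[/eqP <-|]; [left|right].
  by move: qs bs; rewrite s_0 q0 => ->; rewrite ltxx.
pose E t := (p t - a t) ^+ 2 + (q t - b t) ^+ 2.
have cE : continuous E by apply: cont_all => t; rewrite /E; cont.
have ng t : 0 <= t < s -> (p t - l t) ^+ 2 + q t ^+ 2 != 0.
  move=> ts; have ts' : 0 <= t <= s by case/andP: ts => -> /ltW.
  have tI : t \in `[0, s[ by rewrite in_itv.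
  have [h _] := gfl t tI.
  apply/negP => /eqP e; move/negP: h; apply.
  have h1 := sqr_ge0 (p t - l t); have h2 := sqr_ge0 (q t).
  have e1 : (p t - l t) ^+ 2 = 0 by lra.
  have e2 : q t ^+ 2 = 0 by lra.
  move/eqP: e1; move/eqP: e2; rewrite !sqrf_eq0 /p /q clamp_id // subr_eq0 => q00 pl.
  rewrite eq_complex /= q00 (eqP pl) ll ?eqxx //.
  by case/andP: ts' => -> h3; exact: le_trans su.
have dpq t : 0 < t < s ->
    is_derive t 1 p (2 * ((p t - l t) / ((p t - l t) ^+ 2 + q t ^+ 2))) /\
    is_derive t 1 q (- (2 * (q t / ((p t - l t) ^+ 2 + q t ^+ 2)))).
  move=> ts; have /andP[t0 ts1] := ts.
  have tI : 0 <= t <= s by rewrite !ltW.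
  have tI' : t \in `[0, s[ by rewrite in_itv /= (ltW t0).
  have [_ /complex_cvgP h] := gfl t tI'.
  have [f1 f2] := loewner_field (g t) (lambda t).
  rewrite f1 f2 in h.
  have lt : lambda t = l t by rewrite ll // (ltW t0) (le_trans _ su) // ltW.
  rewrite lt in h.
  have pt : complex.Re (g t) = p t by rewrite /p clamp_id.
  have qt : complex.Im (g t) = q t by rewrite /q clamp_id.
  rewrite pt qt in h.
  pose r := Num.min t (s - t).
  have r0 : 0 < r by rewrite lt_min t0 subr_gt0.
  have rA y : `|y - t| < r -> 0 <= y < s.
    by rewrite lt_min !ltr_norml => /andP[/andP[? ?] /andP[? ?]]; apply/andP; split; lra.
  have rA' y : `|y - t| < r -> `[0, s[%classic y.
    by move=> /rA; rewrite /= in_itv.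
  have clA y : `[0, s[%classic y -> clamp 0 s y = y.
    by rewrite /= in_itv /= => /andP[? ?]; rewrite clamp_id //; apply/andP; split; lra.
  split; apply: (der_of_quot r0 rA') => e e0.
    have [d d0 hd] := within_puncturedE (h e e0).
    apply: (within_punctured d0) => y yd yt yA; have [+ _] := hd y yd yt yA.
    by have [-> _] := Re_div_real (g y) (g t) (y - t); rewrite pt [complex.Re (g y)](_ : _ = p y) // /p clA.
  have [d d0 hd] := within_puncturedE (h e e0).
  apply: (within_punctured d0) => y yd yt yA; have [_ +] := hd y yd yt yA.
  by have [_ ->] := Re_div_real (g y) (g t) (y - t); rewrite qt [complex.Im (g y)](_ : _ = q y) // /q clA.
have E0 t : 0 <= t < s -> E t <= 0.
  move=> ts; have /andP[t0 ts'] := ts.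
  have nb x : 0 <= x <= t -> (a x - l x) ^+ 2 + b x ^+ 2 != 0.
    move=> /andP[x0 xt]; rewrite gt_eqF // norm2_gt0 // bp // x0 /=; lra.
  have ng' x : 0 <= x <= t -> (p x - l x) ^+ 2 + q x ^+ 2 != 0.
    by move=> /andP[x0 xt]; apply: ng; rewrite x0 (le_lt_trans xt).
  pose k x := - (4 * (((p x - l x) * (a x - l x) - q x * b x) *
     ((((p x - l x) ^+ 2 + q x ^+ 2)^-1) * (((a x - l x) ^+ 2 + b x ^+ 2)^-1)))).
  apply: (@gronwall_le0 R E (fun x => k x * E x) k 0 t) => //.
  - by move=> x _; exact: cE.
  - move=> x /andP[x0 xt].
    have xI : 0 <= x <= t by rewrite !ltW.
    have h1 := nb x xI; have h2 := ng' x xI.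
    have [d1 d2] : is_derive x 1 p (2 * ((p x - l x) / ((p x - l x) ^+ 2 + q x ^+ 2))) /\
       is_derive x 1 q (- (2 * (q x / ((p x - l x) ^+ 2 + q x ^+ 2)))).
      by apply: dpq; rewrite x0 (lt_trans xt).
    have [d3 d4] := dab x (introT andP (conj x0 (lt_le_trans (lt_trans xt ts') su))).
    have dE : is_derive x 1 (fun x => (p x - a x) ^+ 2 + (q x - b x) ^+ 2) (k x * E x).
      deriv; rewrite /k /E.
      move: h1 h2.
      have -> : a x = (a x - l x) + l x by ring.
      have -> : p x = (p x - l x) + l x by ring.
      rewrite !addrK; move: (a x - l x) (p x - l x) (b x) (q x) => x1 x2 y1 y2 h1 h2.
      by field; rewrite h1 h2.
    exact: dE.
  - by move=> x xt; have h1 := nb x xt; have h2 := ng' x xt; rewrite /k; cont.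
  - by rewrite /E p0 q0 !subrr expr0n addr0.
have Es : E s <= 0 := le0_left_limit s_gt0 (cE s) E0.
move: Es; rewrite /E qs sub0r sqrrN => h.
have := exprn_gt0 2 bs; have := sqr_ge0 (p s - a s); lra.
Qed.

(** * The trace passes through the tips *)

Lemma segment_component (R : realType) (O : set R[i]) (x y x' y' : R) :
  (forall s : R, 0 <= s <= 1 -> O ((x + s * (x' - x)) +i* (y + s * (y' - y)))) ->
  connected_component O (x +i* y) (x' +i* y').
Proof.
move=> H; pose f (s : R) : R[i] := (x + s * (x' - x)) +i* (y + s * (y' - y)).
have cf : continuous f.
  move=> s; apply/complex_cvgP => e e0.
  have c1 : {for s, continuous (fun s : R => x + s * (x' - x))} by cont.
  have c2 : {for s, continuous (fun s : R => y + s * (y' - y))} by cont.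
  move: c1 => /cvgrPdist_le /(_ _ e0) h1; move: c2 => /cvgrPdist_le /(_ _ e0) h2.
  by apply: filterS2 h1 h2 => t k1 k2; split; rewrite distrC.
have cI : connected (f @` `[0, 1]).
  apply: connected_continuous_connected; first exact: segment_connected.
  exact: continuous_subspaceT.
apply: (@connected_component_max _ _ (f @` `[0, 1])) => //.
- exists 0; first by rewrite /= in_itv /= lexx ler01.
  by rewrite /f !mul0r !addr0.
- by move=> _ [s /= + <-]; rewrite in_itv /= => s01; exact: H.
- exists 1; first by rewrite /= in_itv /= lexx ler01.
  by rewrite /f !mul1r !subrKC.
Qed.

(** If x + iy were not on gamma([0, u]), the segment joining it to a nearby
    initial value of a regular flow, which lies outside K_u, would avoid
    gamma([0, u]); the two ends would share a component, and x + iy would be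
    outside K_u.  It is not on gamma([0, s]) because it is outside K_s. *)
Lemma trace_hits_tip (R : realType) (T : R) (lambda l : R -> R) (gamma : R -> R[i])
    (u x y : R) :
  continuous l -> (forall s, 0 <= s <= T -> lambda s = l s) ->
  is_trace T lambda gamma -> 0 < u < T -> tip l u x y ->
  forall s, 0 <= s < u -> exists2 v, s < v <= u & gamma v = x +i* y.
Proof.
move=> cl ll [cg _ tr] /andP[u0 uT] [[a [b [fl [a0 b0] au bu bp]]] app] s /andP[s0 su].
have llu t : 0 <= t <= u -> lambda t = l t.
  by move=> /andP[t0 tu]; rewrite ll // t0 (le_trans tu) // ltW.
have y0 : 0 < y by rewrite -b0 bp // lexx.
have zH : @upper_half_plane R (x +i* y) by [].
have uI : u \in `[0, T[ by rewrite in_itv /= uT ltW.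
have sI : s \in `[0, T[ by rewrite in_itv /= s0 (lt_trans su).
have zK : loewner_hull lambda u (x +i* y).
  by rewrite -a0 -b0; apply: (@hull_mem R lambda l a b u u).
have zK' : ~ loewner_hull lambda s (x +i* y).
  rewrite -a0 -b0; apply: (@hull_notin R lambda l a b s) => //.
  - by move=> t /andP[t0 ts]; apply: llu; rewrite t0 (le_trans ts) // ltW.
  - by apply: flow_restrict fl; exact: ltW.
  - by move=> t /andP[t0 ts]; apply: bp; rewrite t0 (le_lt_trans ts).
have not_s v : 0 <= v <= s -> gamma v <> x +i* y.
  move=> vs gv; apply: zK'.
  have : (@upper_half_plane R `\` unbounded_component
     (@upper_half_plane R `\` gamma @` `[0, s])) (x +i* y).
    by split => // -[[_ +] _]; apply; exists v; rewrite //= in_itv.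
  by rewrite -tr // => -[].
apply: contrapT => no.
have not_u v : 0 <= v <= u -> gamma v <> x +i* y.
  move=> /andP[v0 vu]; have [vs|sv] := leP v s; first by apply: not_s; rewrite v0.
  by move=> gv; apply: no; exists v => //; rewrite sv.
pose O := @upper_half_plane R `\` gamma @` `[0, u].
have [] : ~ unbounded_component O (x +i* y).
  move=> h; have : (loewner_hull lambda u `&` @upper_half_plane R) (x +i* y) by [].
  by rewrite tr // => -[_ []].
(* the distance of x + i y to gamma[0, u] is positive *)
have cG : continuous (gamma \o clamp 0 u).
  apply: within_clamp; first exact: ltW.
  apply: continuous_subspaceW cg => v /=; rewrite !in_itv /= => /andP[-> vu].
  exact: le_lt_trans uT.
pose d v := (complex.Re (gamma (clamp 0 u v)) - x) ^+ 2 +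
            (complex.Im (gamma (clamp 0 u v)) - y) ^+ 2.
have cd : continuous d.
  apply: cont_all => v.
  have c1 : {for v, continuous (fun v : R => complex.Re (gamma (clamp 0 u v)))}.
    apply/cvgrPdist_le => e e0; have /complex_cvgP /(_ _ e0) := cG v.
    by apply: filterS => t [h _]; rewrite distrC.
  have c2 : {for v, continuous (fun v : R => complex.Im (gamma (clamp 0 u v)))}.
    apply/cvgrPdist_le => e e0; have /complex_cvgP /(_ _ e0) := cG v.
    by apply: filterS => t [_ h]; rewrite distrC.
  by rewrite /d; cont.
have [c cu cmin] := EVT_min (ltW u0) (continuous_subspaceT cd).
have dc : 0 < d c.
  have cI : 0 <= c <= u by move: cu; rewrite in_itv.
  rewrite lt_neqAle addr_ge0 ?sqr_ge0 // andbT eq_sym; apply/negP => /eqP.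
  rewrite /d clamp_id // => e; apply: (not_u c cI).
  have h1 := sqr_ge0 (complex.Re (gamma c) - x).
  have h2 := sqr_ge0 (complex.Im (gamma c) - y).
  have /eqP : (complex.Re (gamma c) - x) ^+ 2 = 0 by lra.
  have /eqP : (complex.Im (gamma c) - y) ^+ 2 = 0 by lra.
  rewrite !sqrf_eq0 !subr_eq0 => /eqP e1 /eqP e2.
  by move: e1 e2; case: (gamma c) => ? ? /= -> ->.
(* points of the segment are within squared distance 2 e^2 < d c *)
pose e := Num.min 1 (d c / 4).
have e0 : 0 < e by rewrite lt_min ltr01 divr_gt0.
have e1 : e <= 1 by rewrite ge_min lexx.
have e2 : e <= d c / 4 by rewrite ge_min lexx orbT.
have [a' [b' [fl' bp' ha hb]]] := app e e0.
have b'0 : 0 < b' 0 by apply: bp'; rewrite lexx ltW.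
have wK : ~ loewner_hull lambda u (a' 0 +i* b' 0).
  by apply: (@hull_notin R lambda l a' b' u) => //; exact: ltW.
have wU : unbounded_component O (a' 0 +i* b' 0).
  apply: contrapT => wU; apply: wK.
  have : (@upper_half_plane R `\` unbounded_component O) (a' 0 +i* b' 0) by [].
  by rewrite /O -tr // => -[].
have seg : connected_component O (x +i* y) (a' 0 +i* b' 0).
  apply: segment_component => r /andP[r0 r1]; split.
    rewrite /upper_half_plane /=; have := mulr_ge0 r0 (ltW b'0).
    have : 0 <= (1 - r) * y by rewrite mulr_ge0 ?(ltW y0) // subr_ge0.
    have [r12|r12] := lerP r (1 / 2).
      have : 0 < (1 - r) * y by rewrite mulr_gt0 //; lra.
      lra.
    have : 0 < r * b' 0 by rewrite mulr_gt0 //; lra.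
    lra.
  move=> [v /= + gv]; rewrite in_itv /= => vI.
  have := cmin v; rewrite in_itv /= vI => /(_ isT).
  rewrite {2}/d clamp_id // gv /=.
  have sq z : `|z| <= e -> (r * z) ^+ 2 <= e.
    move=> h; rewrite exprMn -(real_normK (num_real z)).
    have h1 : `|z| ^+ 2 <= e.
      apply: (@le_trans _ _ (e ^+ 2)); first by rewrite lerXn2r ?nnegrE ?(ltW e0).
      by rewrite expr2 ler_piMr // ltW.
    have h2 : r ^+ 2 <= 1 by rewrite expr_le1.
    by apply: le_trans h1; rewrite ler_piMl // sqr_ge0.
  have := sq _ ha; have := sq _ hb.
  rewrite !(addrC _ (r * _)) !addrK.
  by move: e2 dc; move: (d c) => D; lra.
have [wO wB] := wU; split; last by rewrite (same_connected_component seg).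
by split => // -[v /= + gv]; rewrite in_itv /= => /not_u; apply.
Qed.

(** * Limit of the trace *)

Lemma derivable_on_quot (R : realType) (T : R) (f : R -> R) (x : R) :
  derivable_on `[0, T[ f -> 0 <= x < T -> forall e : R, 0 < e ->
  \forall y \near within `[0, T[ x^',
    `|(f y - f x) / (y - x) - derive_on `[0, T[ f x| <= e.
Proof.
move=> df xT e e0; have Ax : `[0, T[%classic x by rewrite /= in_itv.
have /cvgrPdist_le /(_ _ e0) := df x Ax.
by apply: filterS => y; rewrite distrC.
Qed.

Lemma derivable_on_der (R : realType) (T : R) (f : R -> R) (x : R) :
  derivable_on `[0, T[ f -> 0 < x < T -> is_derive x 1 f (derive_on `[0, T[ f x).
Proof.
move=> df /andP[x0 xT]; pose r := Num.min x (T - x).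
have r0 : 0 < r by rewrite lt_min x0 subr_gt0.
apply: (der_of_quot r0 (A := `[0, T[%classic)).
  move=> y; rewrite lt_min !ltr_norml /= in_itv /= => /andP[/andP[? ?] /andP[? ?]].
  by apply/andP; split; lra.
by apply: derivable_on_quot => //; rewrite ltW.
Qed.

Lemma derivable_on_cont (R : realType) (T : R) (f : R -> R) (x : R) :
  0 < T -> derivable_on `[0, T[ f -> x < T ->
  {for x, continuous (fun t : R => f (Num.max 0 t))}.
Proof.
move=> T0 df xT; apply/cvgrPdist_le => e e0.
have mT : 0 <= Num.max 0 x < T by rewrite le_max lexx gt_max T0.
have [r r0 hr] := cont_of_quot (derivable_on_quot df mT) e0.
apply/nbhs_ballP; exists (Num.min r (T - x)); first by rewrite /= lt_min r0 subr_gt0.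
move=> y; rewrite /ball /= distrC lt_min => /andP[yr yT].
rewrite distrC; apply: hr.
  apply: le_lt_trans yr; rewrite !maxEle.
  case: (leP 0 y) => hy; case: (leP 0 x) => hx //.
  - by rewrite !ger0_norm; lra.
  - by rewrite [leRHS]ler0_norm ?ler0_norm; lra.
  - by rewrite subrr normr0.
rewrite /= in_itv /= le_max lexx gt_max T0 /=.
by move: yT; rewrite ltr_norml => /andP[? ?]; lra.
Qed.

(** A zero second derivative makes the curvature infinite, a zero first
    derivative makes it 0; both are excluded. *)
Lemma curvature_bounds (R : realType) (A : set R) (lambda : R -> R) (t : R) :
  (9%:E <= loewner_curvature A lambda t < +oo)%E ->
  derive_on A lambda t != 0 /\
  (0 < derive_on A lambda t -> 0 <= derive_on A (derive_on A lambda) t /\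
     9 * derive_on A (derive_on A lambda) t <= derive_on A lambda t ^+ 3) /\
  (derive_on A lambda t < 0 -> derive_on A (derive_on A lambda) t <= 0 /\
     derive_on A lambda t ^+ 3 <= 9 * derive_on A (derive_on A lambda) t).
Proof.
rewrite /loewner_curvature; set d1 := derive_on A lambda t.
set d2 := derive_on A (derive_on A lambda) t.
case: ifPn => [_ /andP[]|d1n]; first by rewrite lee_fin; lra.
case: ifPn => [_ /andP[]|d2n /andP[+ _]]; first by rewrite ltxx.
rewrite lee_fin => h; split => //.
have e : d1 ^+ 3 = d1 ^+ 3 / d2 * d2 by rewrite divfK.
split => d10; have d3 : d1 ^+ 3 = d1 * d1 ^+ 2 by rewrite exprS.
  have d30 : 0 < d1 ^+ 3 by rewrite exprn_gt0.
  have d20 : 0 < d2.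
    by rewrite -(pmulr_rgt0 _ (_ : 0 < d1 ^+ 3 / d2)) -?e //; lra.
  by split; [exact: ltW|rewrite e ler_pM2r].
have d30 : d1 ^+ 3 < 0 by rewrite d3 nmulr_rlt0 // exprn_even_gt0.
have d20 : d2 < 0.
  by rewrite -(pmulr_rlt0 _ (_ : 0 < d1 ^+ 3 / d2)) -?e //; lra.
by split; [exact: ltW|rewrite e ler_nM2r].
Qed.

(** As lambda' is continuous without zeros, it has constant sign; the
    negative case is the positive one for - lambda. *)
Lemma C2_driving (R : realType) (T : R) (lambda : R -> R) : 0 < T ->
  {within `[0, T], continuous lambda} -> C2_on `[0, T[ lambda ->
  (forall t : R, t \in `[0, T[ ->
    (9%:E <= loewner_curvature `[0%R, T[ lambda t < +oo)%E) ->
  let l := lambda \o clamp 0 T in exists l1 l2,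
    driving T l l1 l2 \/
    driving T (fun t => - l t) (fun t => - l1 t) (fun t => - l2 t).
Proof.
move=> T0 cl [d1 d2 _] LC l.
pose A := `[0, T[%classic : set R.
pose l1 t := derive_on A lambda (Num.max 0 t).
pose l2 t := derive_on A (derive_on A lambda) (Num.max 0 t).
have m0 (t : R) : 0 <= t -> Num.max 0 t = t by move=> t0; rewrite max_r.
have c_l : continuous l by apply: within_clamp => //; exact: ltW.
have cl1 t : t < T -> {for t, continuous l1} by exact: derivable_on_cont.
have dl t : 0 < t < T -> is_derive t 1 l (l1 t) /\ is_derive t 1 l1 (l2 t).
  move=> tT; have t0 : 0 <= t by case/andP: tT => /ltW.
  split; rewrite /l1 /l2 m0 //.
    apply: (@der_local _ _ lambda 0 T) => //; last exact: derivable_on_der.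
    by move=> s /andP[s0 sT]; rewrite /l /= clamp_id // !ltW.
  apply: (@der_local _ _ (derive_on A lambda) 0 T) => //; last exact: derivable_on_der.
  by move=> s /andP[s0 sT]; rewrite m0 // ltW.
have K t (tT : 0 <= t < T) : [/\ l1 t != 0,
    0 < l1 t -> 0 <= l2 t /\ 9 * l2 t <= l1 t ^+ 3 &
    l1 t < 0 -> l2 t <= 0 /\ l1 t ^+ 3 <= 9 * l2 t].
  have tI : t \in `[0, T[ by rewrite in_itv.
  have [h1 [h2 h3]] := curvature_bounds (LC t tI).
  by have t0 : 0 <= t by [case/andP: tT]; rewrite /l1 /l2 m0.
have nz t : 0 <= t < T -> l1 t != 0 by move=> /K[].
have sgn t : 0 <= t < T -> 0 < l1 0 * l1 t.
  move=> /andP[t0 tT]; rewrite ltNge; apply/negP => h.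
  have [c ct lc0] : exists2 c, c \in `[0, t]%R & l1 c = 0.
    apply: IVT => //.
      apply: continuous_in_subspaceT => x; rewrite inE /= in_itv /= => /andP[_ xt].
      by apply: cl1; exact: le_lt_trans tT.
    rewrite ge_min le_max.
    have o0 : (0 : R) <= 0 < T by rewrite lexx T0.
    have := nz 0 o0; rewrite neq_lt => /orP[l0|l0].
      by rewrite nmulr_rle0 // in h; rewrite (ltW l0) h orbT.
    by rewrite pmulr_rle0 // in h; rewrite (ltW l0) h orbT.
  move: ct; rewrite in_itv /= => /andP[c0 ct].
  by have := nz c; rewrite c0 (le_lt_trans ct tT) lc0 eqxx => /(_ isT).
exists l1, l2.
have o0 : (0 : R) <= 0 < T by rewrite lexx T0.
have [l0|l0] := ltP 0 (l1 0).
  have pos t : 0 <= t < T -> 0 < l1 t by move=> /sgn; rewrite pmulr_rgt0.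
  left; split => // t /andP[t0 tT].
  have tI : 0 <= t < T by rewrite ltW.
  by have [_ h _] := K t tI; apply: h; exact: pos.
have {}l0 : l1 0 < 0 by rewrite lt_neqAle nz.
have neg t : 0 <= t < T -> l1 t < 0 by move=> /sgn; rewrite nmulr_rgt0.
right; split.
- by apply: cont_all => t; cont.
- by move=> t tT; have c := cl1 t tT; cont.
- by move=> t tT; have [h1 h2] := dl t tT; split; apply: der_opp.
- by move=> t tT; rewrite oppr_gt0 neg.
- move=> t /andP[t0 tT]; have tI : 0 <= t < T by rewrite ltW.
  have [_ _ h] := K t tI; have [h1 h2] := h (neg t tI).
  have -> : (- l1 t) ^+ 3 = - l1 t ^+ 3 by ring.
  by split; lra.
Qed.

Theorem proposition1p3 (R : realType) (T : R) (lambda : R -> R)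
    (T_gt0 : 0 < T)
    (lambda_cont : {within `[0, T], continuous lambda})
    (lambda_C2 : C2_on `[0, T[ lambda)
    (lambda_T : forall t : R, t \in `[0, T[ ->
       4 * Num.sqrt (T - t) <= `|lambda T - lambda t|)
    (LC_bounds : forall t : R, t \in `[0, T[ ->
       (9%:E <= loewner_curvature `[0%R, T[ lambda t < +oo)%E)
    (LC_inf : exists2 delta : R, 0 < delta & forall s : R, s \in `]0, T[ ->
       ((delta * Num.sqrt (T - s) * `|derive_on `[0, T[ lambda s|)%:E <=
        ereal_inf [set loewner_curvature `[0%R, T[ lambda t | t in `[s, T[])%E)
    (gamma : R -> R[i]) (gamma_trace : is_trace T lambda gamma) :
  exists x : R, gamma t @[t --> T^'-] --> x%:C.
Proof.
pose l := lambda \o clamp 0 T.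
have cl : continuous l by apply: within_clamp => //; exact: ltW.
have ll s : 0 <= s <= T -> lambda s = l s by move=> sT; rewrite /l /= clamp_id.
have HG t : 0 <= t < T -> 16 * (T - t) <= (l T - l t) ^+ 2.
  move=> tT; have /andP[t0 tT'] := tT; have Tt : 0 <= T - t by rewrite subr_ge0 ltW.
  have tI : t \in `[0, T[ by rewrite in_itv.
  have := lambda_T t tI; rewrite !ll ?lexx ?t0 ?(ltW tT') ?(ltW T_gt0) // => h.
  rewrite -(real_normK (num_real (l T - l t))) -(sqr_sqrtr Tt).
  have -> : 16 * Num.sqrt (T - t) ^+ 2 = (4 * Num.sqrt (T - t)) ^+ 2 by ring.
  by rewrite lerXn2r ?nnegrE // mulr_ge0 ?sqrtr_ge0.
have [p tips] : exists p : R, forall e : R, 0 < e -> exists2 t0, 0 <= t0 < T &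
    forall u, t0 < u < T -> exists x y, [/\ tip l u x y, `|x - p| <= e & `|y| <= e].
  have [l1 [l2 [dr|dr]]] := C2_driving T_gt0 lambda_cont lambda_C2 LC_bounds.
    exact: tips_converge dr HG.
  have HG' t : 0 <= t < T -> 16 * (T - t) <= (- l T - - l t) ^+ 2.
    by move=> tT; rewrite -opprD sqrrN; exact: HG.
  have [p tips] := tips_converge T_gt0 dr HG'.
  exists (- p) => e e0; have [t0 t0T h] := tips e e0; exists t0 => // u uT.
  have [x [y [hx hp hy]]] := h u uT; exists (- x), y; split => //.
    exact: tip_opp.
  by rewrite -opprD normrN.
exists p; apply/complex_cvgP => e e0 /=.
have [t0 /andP[t00 t0T] ht0] := tips e e0.
have [cg _ _] := gamma_trace.
near=> t.
have t0t : t0 < t by near: t; exact: nbhs_left_gt.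
have tT : t < T by near: t; exact: nbhs_left_lt.
have tt : 0 <= t by rewrite (le_trans t00) // ltW.
have cgt : gamma @ within `[0, T[ (nbhs t) --> gamma t.
  by move/subspace_continuousP : cg; apply; rewrite /= in_itv /= tt.
(* gamma passes through tips at times v decreasing to t *)
have app h : 0 < h -> exists v x y, [/\ gamma v = x +i* y,
    `|x - p| <= e, `|y| <= e, `|complex.Re (gamma v) - complex.Re (gamma t)| <= h &
    `|complex.Im (gamma v) - complex.Im (gamma t)| <= h].
  move=> h0; move/complex_cvgP : cgt => /(_ h h0) /nbhs_ballP[d /= d0 hd].
  pose u := Num.min (t + d / 2) ((t + T) / 2).
  have tu : t < u by rewrite lt_min; apply/andP; split; lra.
  have uT : u < T by rewrite gt_min; apply/orP; right; lra.
  have ud : u <= t + d / 2 by rewrite ge_min lexx.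
  have u0 : 0 < u by rewrite (le_lt_trans tt).
  have [x [y [tipu hx hy]]] := ht0 u (introT andP (conj (lt_trans t0t tu) uT)).
  have [v /andP[tv vu] gv] := trace_hits_tip cl ll gamma_trace
     (introT andP (conj u0 uT)) tipu (introT andP (conj tt tu)).
  exists v, x, y; split => //.
    apply: (hd v _ _).1; first by rewrite /ball /= ler0_norm; lra.
    by rewrite /= in_itv /= (le_trans tt (ltW tv)) (le_lt_trans vu).
  apply: (hd v _ _).2; first by rewrite /ball /= ler0_norm; lra.
  by rewrite /= in_itv /= (le_trans tt (ltW tv)) (le_lt_trans vu).
split; apply/ler_addgt0Pl => h h0; have [v [x [y [gv hx hy h1 h2]]]] := app h h0.
  move: h1 hx; rewrite gv /= !ler_norml => /andP[? ?] /andP[? ?].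
  by apply/andP; split; lra.
move: h2 hy; rewrite gv /= !ler_norml => /andP[? ?] /andP[? ?].
by apply/andP; split; lra.
Unshelve. all: by end_near. Qed.
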